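(* Let $M^m$, $m>1$, be a Cauchy surface of a globally hyperbolic space-time, and let two cooriented oriented fronts $W_1,W_2$ on $M$ (the projections to $M$ of the two components of a Legendrian link in $ST^*M$ moving along a generic path in $\mathcal L\times\mathcal L$) pass through a dangerous tangency. Consider a positively oriented chart $(x_1,\dots,x_m)$ on $M$ such that the dangerous tangency happens at the origin, where the common normal vector to the immersed branches of the two fronts that defines their lift to $STM$ is $-\frac{\partial}{\partial x_m}$. Locally the two fronts $W_1,W_2$ can be expressed as graphs of some functions $x_m=f_i(x_1,x_2,\dots,x_{m-1})$, $i=1,2$. Let $\sigma$ be the number of negative eigenvalues of the Hessian of $f_2-f_1$ at the origin. Let $\epsilon=+1$ if the two oriented immersed tangent branches induce the same orientation on the common tangent $(m-1)$-plane, and $\epsilon=-1$ otherwise. Let $\alpha=+1$ (respectively $\alpha=-1$) if the $x_m$-coordinate of the point of $W_1$ projecting to the origin in the $(x_1,x_2,\dots,x_{m-1})$-hyperplane after the move is larger (respectively less) than the $x_m$-coordinate of the corresponding point on $W_2$ after the move. Then under the passage through this dangerous tangency $\mathrm{alk}$ increases by $\epsilon\alpha(-1)^{\sigma}$. (Since $\mathrm{alk}$ always takes values either in $\mathbb Z$ or in $\mathbb Z_n$, this expression makes sense; it stands for its image $q(\epsilon\alpha(-1)^{\sigma})\in\mathcal A(M)$.)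
   Context: Everything is $C^\infty$. A space-time is a connected, oriented, time-oriented Lorentz manifold; a Cauchy surface is a smooth spacelike hypersurface met exactly once by every inextendible non-spacelike curve, and it is a connected oriented manifold. The Riemannian metric on $M$ identifies the spherical tangent bundle $STM$ with the spherical cotangent bundle $\mathrm{pr}:ST^*M=(T^*M\setminus 0)/\mathbb R^+\to M$. The total space $ST^*M$ carries its canonical orientation, and the fibers $S^{m-1}$ are oriented so that (orientation of the base, orientation of the fiber) gives the orientation of $ST^*M$. $ST^*M$ has the contact structure $\eta_p=(d\,\mathrm{pr})^{-1}(\ker p)$; an immersion $f:S^{m-1}\to ST^*M$ is Legendrian if $df(TS^{m-1})\subset\eta$. Its front $\mathrm{pr}\circ f$ is equipped with the codirection field (equivalently, via the metric, the normal direction field) defining the lift $f$. For $v\in M$, $\varepsilon_v:S^{m-1}\to ST^*M$ is an orientation preserving diffeomorphism onto the positively oriented fiber over $v$. $\mathcal S$ is the component of the space of smooth maps $S^{m-1}\to ST^*M$ consisting of maps homotopic to $\varepsilon_v$; $\mathcal L\subset\mathcal S$ is the connected component of the space of Legendrian immersions $S^{m-1}\to ST^*M$ that contains the Legendrian embeddings $\varepsilon_w$, $w\in M$. $\Sigma\subset\mathcal S\times\mathcal S$ is the set of $(f_1,f_2)$ with $f_1(s_1)=f_2(s_2)$ for some $s_1,s_2$. $\Sigma_0\subset\Sigma$ is the set of pairs with exactly one such $(s_1,s_2)$, for which moreover $s_i$ is a regular point of $f_i$, $i=1,2$, and $df_1(T_{s_1}S^{m-1})\cap df_2(T_{s_2}S^{m-1})=0$.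 Let $(f_1,f_2)\in\Sigma_0$ with double point $z=f_1(s_1)=f_2(s_2)$. To a resolution $(\bar f_1,\bar f_2)$ of it (a $C^\infty$-small deformation of $(f_1,f_2)$) associate the vector $\mathbf w\in T_z(ST^*M)$ that in a chart has the same direction as the vector from $\bar f_1(s_1)$ to $\bar f_2(s_2)$. The resolution is generic if $d\bar f_1(T_{s_1}S^{m-1})$, $\mathbf w$, $d\bar f_2(T_{s_2}S^{m-1})$ span $T_z(ST^*M)$; a generic resolution is positive if, for positive frames $\mathfrak r_i$ of $T_{s_i}S^{m-1}$, the frame $\{df_1(\mathfrak r_1),\mathbf w,df_2(\mathfrak r_2)\}$ gives the orientation of $ST^*M$, and negative otherwise. A path $\gamma(t)$ in $\mathcal S\times\mathcal S$ crosses $\Sigma_0$ transversally at $t_0$ if $\gamma(t_0)\in\Sigma_0$ and the resolution $\gamma(t)$ is generic for $t\ne t_0$ close to $t_0$; the sign $\sigma(\gamma,t_0)=\pm1$ of the crossing is the sign of the resolution induced by $\gamma$ (i.e. by $\gamma(t)$ for $t$ slightly bigger than $t_0$). A path is generic if it meets $\Sigma$ finitely many times, each time by a transverse crossing of $\Sigma_0$. Dangerous tangency: for a generic path in $\mathcal L\times\mathcal L$ the crossings of $\Sigma$ are the instances when immersed branches of the two fronts are tangent at exactly one point, this point has exactly one preimage on each of the two spheres, and the covectors (equivalently, the normals) defining the Legendrian lifts of the two fronts at the tangency point are positive multiples of each other. $\mathcal B=\{(\phi_1,\phi_2,s_1,s_2)\in\mathcal S\times\mathcal S\times S^{m-1}\times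 S^{m-1}:\phi_1(s_1)=\phi_2(s_2)\}$. $\Omega_n$ denotes oriented bordism. The pairing $\mu_{ij}:\Omega_i(\mathcal S)\otimes\Omega_j(\mathcal S)\to\Omega_{i+j-1}(\mathcal B)$ sends $[\alpha_1:F_1\to\mathcal S],[\alpha_2:F_2\to\mathcal S]$, with adjoints $\widetilde\alpha_l(f,s)=\alpha_l(f)(s)$ made transverse, to the class of $V=\{(f_1,s_1,f_2,s_2):\widetilde\alpha_1(f_1,s_1)=\widetilde\alpha_2(f_2,s_2)\}$ (oriented as the transverse preimage of the diagonal) with the map $(f_1,s_1,f_2,s_2)\mapsto(\alpha_1(f_1),\alpha_2(f_2),s_1,s_2)$. $\mathrm{Indet}\subset\Omega_0(\mathcal B)$ is the subgroup generated by the images of $\mu_{0,1},\mu_{1,0}$; $\mathcal A(M)=\Omega_0(\mathcal B)/\mathrm{Indet}$ and $q:\Omega_0(\mathcal B)\to\mathcal A(M)$ is the quotient map. $\mathcal B$ is path connected, so $\Omega_0(\mathcal B)=\mathbb Z$ via augmentation, and $\mathcal A(M)$ is $\mathbb Z$ or a finite cyclic group $\mathbb Z_n$. $\mathrm{alk}:\mathcal S\times\mathcal S\setminus\Sigma\to\mathcal A(M)$ is the unique function that is constant on path components, satisfies $\mathrm{alk}(\gamma(b))-\mathrm{alk}(\gamma(a))=q\big(\sum_i\sigma(\gamma,t_i)\big)$ for every generic path $\gamma:[a,b]\to\mathcal S\times\mathcal S$ with endpoints off $\Sigma$ and crossing times $t_i$, and is normalized by $\mathrm{alk}(\varepsilon_u,\varepsilon_v)=0$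 for $u\ne v$. Here $\mathrm{alk}$ is evaluated on the ordered pair (lift of $W_1$, lift of $W_2$).
   Formalization: A transverse crossing of Σ_0 is additionally required to be transverse to first order: the time derivative at t_0 of the resolution vector w must be transverse to df_1 and df_2; otherwise a path that only touches Σ_0 (f_1=0, f_2=x^2+t^2) has jump 0, against the formula. *)

(* Defs.v *)
From HB Require Import structures.
From mathcomp Require Import all_boot all_order all_algebra.
From mathcomp Require Import all_classical all_reals all_analysis.

Set Implicit Arguments.
Unset Strict Implicit.
Unset Printing Implicit Defensive.

Import Order.TTheory GRing.Theory Num.Theory.
Import numFieldNormedType.Exports.

Local Open Scope classical_set_scope.
Local Open Scope ring_scope.

(* Vectors and covectors are rows.  [jacobian f x] acts on row vectors on the
   right: 'd f x v = v *m jacobian f x; a covector xi pairs with a vector v as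
   xi *m v^T. *)

(** * Smooth maps between normed spaces *)

(* Meant for U open. *)
Fixpoint Ck (R : realType) (k : nat) (V W : normedModType R) (U : set V)
    (f : V -> W) : Prop :=
  if k is k'.+1 then
    (forall x, U x -> differentiable f x) /\
    (forall v : V, Ck k' U (fun x => 'D_v f x))
  else forall x, U x -> {for x, continuous f}.

Definition Cinf (R : realType) (V W : normedModType R) (U : set V)
  (f : V -> W) : Prop := forall k, Ck k U f.

(** * Manifolds *)

(* The data of an atlas; the topology is the one the charts generate
   ([mopen]), and the axioms are those of [oriented_manifold].  The family of
   charts is arbitrary: it may be a maximal oriented atlas, in which case
   "positively oriented chart" means "member of the family". *)
Record charted (R : realType) (d : nat) := Charted {
  pt :> Type;
  chart : Type;
  cdom : chart -> set pt;
  cmap : chart -> pt -> 'rV[R]_d }.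
Arguments cdom {R d c}.
Arguments cmap {R d c}.
Arguments chart {R d}.

Definition mopen (R : realType) d (M : charted R d) (A : set M) : Prop :=
  forall c : chart M, open (cmap c @` (A `&` cdom c)).

(* The coordinate expression of h in the charts c and c'; it takes a default
   value outside cmap c @` (cdom c `&` h @^-1` cdom c'). *)
Definition loc_rep (R : realType) d e (M : charted R d) (N : charted R e)
    (h : M -> N) (c : chart M) (c' : chart N) (x : 'rV[R]_d) : 'rV[R]_e :=
  get [set y | exists p, [/\ cdom c p, cmap c p = x, cdom c' (h p)
                           & y = cmap c' (h p)]].

Definition transition (R : realType) d (M : charted R d) (c c' : chart M) :
  'rV[R]_d -> 'rV[R]_d := loc_rep (fun p : M => p) c c'.

Definition transition_jac (R : realType) d (M : charted R d) (c c' : chart M)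
  (p : M) : 'M[R]_d := jacobian (transition c c') (cmap c p).

Record oriented_manifold (R : realType) d (M : charted R d) : Prop := {
  mfd_cover : forall p : M, exists c : chart M, cdom c p;
  mfd_inj : forall (c : chart M) (p q : M),
    cdom c p -> cdom c q -> cmap c p = cmap c q -> p = q;
  mfd_open : forall c : chart M, mopen (cdom c);
  mfd_smooth : forall c c' : chart M,
    Cinf (cmap c @` (cdom c `&` cdom c')) (transition c c');
  mfd_oriented : forall (c c' : chart M) (p : M),
    cdom c p -> cdom c' p -> 0 < \det (transition_jac c c' p);
  mfd_hausdorff : forall p q : M, p <> q -> exists A B : set M,
    [/\ mopen A, mopen B, A p, B q & A `&` B = set0];
  mfd_second_countable : exists B : nat -> set M, (forall i, mopen (B i)) /\
    forall (A : set M) p, mopen A -> A p -> exists i, B i p /\ B i `<=` A;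
  mfd_connected : forall A : set M,
    mopen A -> mopen (~` A) -> A = set0 \/ A = setT }.

Definition smooth_map (R : realType) (V : normedModType R) d (N : charted R d)
    (U : set V) (g : V -> N) : Prop :=
  forall x, U x -> exists (c : chart N) (W : set V),
    [/\ open W, W x, W `<=` U, forall y, W y -> cdom c (g y)
      & Cinf W (fun y => cmap c (g y))].

Definition mfd_smooth_map (R : realType) d e (M : charted R d)
    (N : charted R e) (h : M -> N) : Prop :=
  forall (p : M) (c : chart M) (c' : chart N), cdom c p -> cdom c' (h p) ->
    exists W : set 'rV[R]_d,
      [/\ open W, W (cmap c p), W `<=` cmap c @` (cdom c `&` h @^-1` cdom c')
        & Cinf W (loc_rep h c c')].

(** * Tensors, space-times and Cauchy surfaces *)

(* A symmetric 2-tensor is given by its matrix as a function of the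
   coordinates of each chart. *)
Definition metric_data (R : realType) d (M : charted R d) :=
  chart M -> 'rV[R]_d -> 'M[R]_d.

Definition qform (R : realType) d (G : 'M[R]_d) (v : 'rV[R]_d) : R :=
  (v *m G *m v^T) 0 0.

Record metric_tensor (R : realType) d (M : charted R d) (g : metric_data M) :
    Prop := {
  metric_smooth : forall c : chart M, Cinf (cmap c @` cdom c) (g c);
  metric_sym : forall (c : chart M) p, cdom c p ->
    (g c (cmap c p))^T = g c (cmap c p);
  metric_change : forall (c c' : chart M) p, cdom c p -> cdom c' p ->
    g c (cmap c p) = transition_jac c c' p *m g c' (cmap c' p)
                       *m (transition_jac c c' p)^T }.

Definition riemannian (R : realType) d (M : charted R d) (g : metric_data M) :
    Prop :=
  metric_tensor g /\
  forall (c : chart M) p v, cdom c p -> v != 0 -> 0 < qform (g c (cmap c p)) v.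

Definition minkowski (R : realType) (d : nat) : 'M[R]_(d + 1) :=
  block_mx 1%:M 0 0 (-1)%:M.

Definition lorentzian (R : realType) d (X : charted R (d + 1))
    (g : metric_data X) : Prop :=
  metric_tensor g /\
  forall (c : chart X) p, cdom c p -> exists P : 'M[R]_(d + 1),
    P \in unitmx /\ P *m g c (cmap c p) *m P^T = minkowski R d.

Definition time_orientation (R : realType) d (X : charted R d)
    (g : metric_data X) (tau : chart X -> 'rV[R]_d -> 'rV[R]_d) : Prop :=
  [/\ forall c : chart X, Cinf (cmap c @` cdom c) (tau c),
      forall (c c' : chart X) p, cdom c p -> cdom c' p ->
        tau c' (cmap c' p) = tau c (cmap c p) *m transition_jac c c' p
    & forall (c : chart X) p, cdom c p ->
        qform (g c (cmap c p)) (tau c (cmap c p)) < 0].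

Record space_time (R : realType) d (X : charted R (d + 1))
    (g : metric_data X) : Prop := {
  st_manifold : oriented_manifold X;
  st_lorentz : lorentzian g;
  st_time : exists tau, time_orientation g tau }.

(* Curves are parametrized by the whole line; every open interval can be
   reparametrized this way. *)
Definition nonspacelike_curve (R : realType) d (X : charted R d)
    (g : metric_data X) (lambda : R -> X) : Prop :=
  smooth_map [set: R] lambda /\
  forall (c : chart X) t, cdom c (lambda t) ->
    let v := 'D_1 (fun u : R => cmap c (lambda u)) t in
    v != 0 /\ qform (g c (cmap c (lambda t))) v <= 0.

Definition has_endpoint (R : realType) d (X : charted R d) (F : set_system R)
    (lambda : R -> X) : Prop :=
  exists q : X, forall A : set X, mopen A -> A q ->
    \forall t \near F, A (lambda t).

Definition inextendible (R : realType) d (X : charted R d) (lambda : R -> X) :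
    Prop :=
  ~ has_endpoint (pinfty_nbhs R) lambda /\
  ~ has_endpoint (ninfty_nbhs R) lambda.

Record cauchy_surface (R : realType) d (M : charted R d)
    (X : charted R (d + 1)) (g : metric_data X) (iota : M -> X) : Prop := {
  cs_smooth : mfd_smooth_map iota;
  cs_inj : injective iota;
  cs_embedding : forall A : set M, mopen A ->
    exists B : set X, mopen B /\ A = iota @^-1` B;
  (* being spacelike makes iota an immersion *)
  cs_spacelike : forall (c : chart M) (c' : chart X) p v,
    cdom c p -> cdom c' (iota p) -> v != 0 ->
    0 < qform (g c' (cmap c' (iota p)))
          (v *m jacobian (loc_rep iota c c') (cmap c p));
  cs_met_once : forall lambda : R -> X,
    nonspacelike_curve g lambda -> inextendible lambda ->
    exists! t, exists p, lambda t = iota p }.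

(* A globally hyperbolic space-time is one that has a Cauchy surface. *)
Definition is_cauchy_surface_of_globally_hyperbolic (R : realType) d
    (M : charted R d) : Prop :=
  oriented_manifold M /\
  exists (X : charted R (d + 1)) (g : metric_data X) (iota : M -> X),
    space_time g /\ cauchy_surface g iota.

(** * The sphere S^n in R^(n+1) *)

Definition sqnorm (R : realType) d (x : 'rV[R]_d) : R := \sum_i x 0 i ^+ 2.

Definition sphere (R : realType) (n : nat) :=
  {x : 'rV[R]_(n + 1) | sqnorm x == 1}.

Lemma sqnorm_pole (R : realType) (n : nat) :
  sqnorm (row_mx 0 1 : 'rV[R]_(n + 1)) == 1.
Proof.
rewrite /sqnorm big_split_ord /= big1 ?add0r => [|i _]; last first.
  by rewrite row_mxEl mxE expr0n.
by rewrite big_ord_recl big_ord0 addr0 row_mxEr mxE eqxx expr1n.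
Qed.

Definition pole (R : realType) (n : nat) : sphere R n :=
  exist _ (row_mx 0 1) (sqnorm_pole R n).

(* Radial projection; the value at 0 is irrelevant.  A map phi on the sphere is
   handled through its 0-homogeneous extension phi \o sph_proj. *)
Definition sph_proj (R : realType) n (x : 'rV[R]_(n + 1)) : sphere R n :=
  insubd (pole R n) ((Num.sqrt (sqnorm x))^-1 *: x).

Definition tangent (R : realType) n (s : sphere R n) (v : 'rV[R]_(n + 1)) :
  Prop := v *m (val s)^T = 0.

(* The rows of r form a positive frame of T_s S^n. *)
Definition pos_frame (R : realType) n (s : sphere R n)
    (r : 'M[R]_(n, n + 1)) : Prop :=
  r *m (val s)^T = 0 /\ 0 < \det (col_mx r (val s)).

Definition sph_smooth (R : realType) n d (N : charted R d)
    (phi : sphere R n -> N) : Prop :=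
  smooth_map [set x : 'rV[R]_(n + 1) | x != 0] (fun x => phi (sph_proj x)).

(* The coordinates in the chart C of d phi (v), v in T_s S^n. *)
Definition sph_diff (R : realType) n d (N : charted R d) (C : chart N)
    (phi : sphere R n -> N) (s : sphere R n) (v : 'rV[R]_(n + 1)) :
    'rV[R]_d :=
  'D_v (fun x : 'rV[R]_(n + 1) => cmap C (phi (sph_proj x))) (val s).

Definition sph_diff_frame (R : realType) n d (N : charted R d) (C : chart N)
    (phi : sphere R n -> N) (s : sphere R n) (r : 'M[R]_(n, n + 1)) :
    'M[R]_(n, d) :=
  \matrix_(i < n) sph_diff C phi s (row i r).

Definition regular_at (R : realType) n d (N : charted R d)
    (phi : sphere R n -> N) (s : sphere R n) : Prop :=
  forall (C : chart N) v, cdom C (phi s) -> tangent s v ->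
    sph_diff C phi s v = 0 -> v = 0.

Definition sph_immersion (R : realType) n d (N : charted R d)
    (phi : sphere R n -> N) : Prop :=
  sph_smooth phi /\ forall s, regular_at phi s.

(* A smooth path on [a, b] is the restriction of one on a larger interval. *)
Definition smooth_path (R : realType) n d (N : charted R d) (a b : R)
    (gamma : R -> sphere R n -> N) : Prop :=
  exists2 e : R, 0 < e &
    smooth_map [set tx : R * 'rV[R]_(n + 1) |
                  a - e < tx.1 < b + e /\ tx.2 != 0]
               (fun tx => gamma tx.1 (sph_proj tx.2)).

Definition joined_in (R : realType) n d (N : charted R d)
    (P : (sphere R n -> N) -> Prop) (phi psi : sphere R n -> N) : Prop :=
  exists gamma : R -> sphere R n -> N,
    [/\ smooth_path 0 1 gamma, gamma 0 = phi, gamma 1 = psi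
      & forall t, 0 <= t <= 1 -> P (gamma t)].

(** * The spherical cotangent bundle *)

(* [r c xi]: the covector at p with coordinates xi in c belongs to the ray. *)
Definition is_ray (R : realType) d (M : charted R d) (p : M)
    (r : chart M -> set 'rV[R]_d) : Prop :=
  exists (c : chart M) (xi : 'rV[R]_d), [/\ cdom c p, xi != 0 &
    forall c' xi', r c' xi' <->
      cdom c' p /\
      exists2 l : R, 0 < l & l *: xi = xi' *m (transition_jac c c' p)^T].

Record cosphere_pt (R : realType) d (M : charted R d) := CospherePt {
  base : M;
  ray : chart M -> set 'rV[R]_d;
  rayP : is_ray base ray }.

Definition posdet (R : realType) d := {A : 'M[R]_d | 0 < \det A}.

Definition cosphere_dom (R : realType) n (M : charted R (n + 1))
    (C : chart M * posdet R (n + 1)) : set (cosphere_pt M) :=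
  [set z | exists eta : 'rV[R]_n, ray z C.1 (row_mx eta 1 *m val C.2)].

Definition cosphere_map (R : realType) n (M : charted R (n + 1))
    (C : chart M * posdet R (n + 1)) (z : cosphere_pt M) : 'rV[R]_(n + 1 + n) :=
  row_mx (cmap C.1 (base z))
         (get [set eta : 'rV[R]_n | ray z C.1 (row_mx eta 1 *m val C.2)]).

(* ST^*M.  The chart (c, A) has coordinates (x, eta), where x are the
   coordinates in c of the base point and (eta, 1) A those of a covector of the
   ray.  Since det A > 0, these charts are the positive ones for the following
   canonical orientation: T^*M is oriented by (x_1..x_m, xi_1..xi_m), which does
   not depend on the orientation of M, and ST^*M so that (orientation of
   ST^*M, outward radial direction of T^*M) is the orientation of T^*M.
   Consequently the fibers, oriented by (base, fiber), are oriented by eta. *)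
Definition cosphere (R : realType) n (M : charted R (n + 1)) :
    charted R (n + 1 + n) :=
  Charted (@cosphere_dom R n M) (@cosphere_map R n M).

Definition front (R : realType) n (M : charted R (n + 1))
    (phi : sphere R n -> cosphere M) (s : sphere R n) : M := base (phi s).

(* The contact hyperplane eta_z = (d pr)^{-1} (ker z), in the chart C; the
   differential of pr is [lsubmx] in the charts C and C.1. *)
Definition contact (R : realType) n (M : charted R (n + 1))
    (C : chart (cosphere M)) (z : cosphere M) (u : 'rV[R]_(n + 1 + n)) : Prop :=
  forall xi, ray z C.1 xi -> xi *m (lsubmx u)^T = 0.

Definition legendrian_immersion (R : realType) n (M : charted R (n + 1))
    (phi : sphere R n -> cosphere M) : Prop :=
  sph_immersion phi /\
  forall s (C : chart (cosphere M)) v, cdom C (phi s) -> tangent s v ->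
    contact C (phi s) (sph_diff C phi s v).

(* e is an orientation preserving diffeomorphism onto the fiber over v. *)
Definition fiber_diffeo (R : realType) n (M : charted R (n + 1)) (v : M)
    (e : sphere R n -> cosphere M) : Prop :=
  [/\ sph_immersion e, injective e, range e = [set z | base z = v]
    & forall s r (C : chart (cosphere M)), cdom C (e s) -> pos_frame s r ->
        0 < \det (rsubmx (sph_diff_frame C e s r))].

(* All eps_w lie in one component of the space of Legendrian immersions. *)
Definition fiber_family (R : realType) n (M : charted R (n + 1))
    (eps : M -> sphere R n -> cosphere M) : Prop :=
  (forall v, fiber_diffeo v (eps v)) /\
  (forall u v, joined_in (@legendrian_immersion R n M) (eps u) (eps v)).

Definition spaceS (R : realType) n (M : charted R (n + 1))
    (eps : M -> sphere R n -> cosphere M) (phi : sphere R n -> cosphere M) :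
    Prop :=
  exists v, joined_in (fun _ => True) (eps v) phi.

Definition spaceL (R : realType) n (M : charted R (n + 1))
    (eps : M -> sphere R n -> cosphere M) (phi : sphere R n -> cosphere M) :
    Prop :=
  exists v, joined_in (@legendrian_immersion R n M) (eps v) phi.

(** * The discriminant and its crossings *)

Definition Sigma (R : realType) n (M : charted R (n + 1))
    (phi1 phi2 : sphere R n -> cosphere M) : Prop :=
  exists s1 s2, phi1 s1 = phi2 s2.

(* (phi1, phi2) is in Sigma_0, with double point phi1 s1 = phi2 s2. *)
Definition Sigma0_at (R : realType) n (M : charted R (n + 1))
    (phi1 phi2 : sphere R n -> cosphere M) (s1 s2 : sphere R n) : Prop :=
  [/\ phi1 s1 = phi2 s2,
      forall u1 u2, phi1 u1 = phi2 u2 -> u1 = s1 /\ u2 = s2,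
      regular_at phi1 s1, regular_at phi2 s2
    & forall (C : chart (cosphere M)) v1 v2,
        cdom C (phi1 s1) -> tangent s1 v1 -> tangent s2 v2 ->
        sph_diff C phi1 s1 v1 = sph_diff C phi2 s2 v2 ->
        sph_diff C phi1 s1 v1 = 0].

(* The determinant of the frame {d phi1 (r1), w, d phi2 (r2)} in the chart C. *)
Definition res_det (R : realType) n (M : charted R (n + 1))
    (C : chart (cosphere M)) (phi1 phi2 : sphere R n -> cosphere M)
    (s1 s2 : sphere R n) (r1 r2 : 'M[R]_(n, n + 1)) (w : 'rV[R]_(n + 1 + n)) :
    R :=
  \det (col_mx (col_mx (sph_diff_frame C phi1 s1 r1) w)
               (sph_diff_frame C phi2 s2 r2)).

(* The vector from phi1 s1 to phi2 s2 in the chart C. *)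
Definition res_vector (R : realType) n (M : charted R (n + 1))
    (C : chart (cosphere M)) (phi1 phi2 : sphere R n -> cosphere M)
    (s1 s2 : sphere R n) : 'rV[R]_(n + 1 + n) :=
  cmap C (phi2 s2) - cmap C (phi1 s1).

Definition res_generic (R : realType) n (M : charted R (n + 1))
    (C : chart (cosphere M)) (psi1 psi2 : sphere R n -> cosphere M)
    (s1 s2 : sphere R n) (r1 r2 : 'M[R]_(n, n + 1)) : Prop :=
  res_det C psi1 psi2 s1 s2 r1 r2 (res_vector C psi1 psi2 s1 s2) != 0.

(* (gamma1, gamma2) crosses Sigma_0 transversally at t0, with sign e and double
   point gamma1 t0 s1 = gamma2 t0 s2.  The second clause asks that the
   resolution vector be transverse to the branches to first order; without it
   the resolutions for t <> t0 could be generic for a motion that only touches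
   Sigma, or only because z is slid along one of the branches, and the sign
   would depend on the chart and on the parametrizations. *)
Definition crossing_at (R : realType) n (M : charted R (n + 1))
    (gamma1 gamma2 : R -> sphere R n -> cosphere M) (t0 : R) (e : int)
    (s1 s2 : sphere R n) : Prop :=
  [/\ Sigma0_at (gamma1 t0) (gamma2 t0) s1 s2, e = 1 \/ e = -1 &
    forall (C : chart (cosphere M)) r1 r2, cdom C (gamma1 t0 s1) ->
      pos_frame s1 r1 -> pos_frame s2 r2 ->
      [/\ res_det C (gamma1 t0) (gamma2 t0) s1 s2 r1 r2
            ('D_1 (fun t : R => res_vector C (gamma1 t) (gamma2 t) s1 s2) t0)
            != 0,
          \forall t \near t0^',
            res_generic C (gamma1 t) (gamma2 t) s1 s2 r1 r2
        & \forall t \near t0^'+,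
            0 < e%:~R * res_det C (gamma1 t0) (gamma2 t0) s1 s2 r1 r2
                          (res_vector C (gamma1 t) (gamma2 t) s1 s2)]].

Definition crossing (R : realType) n (M : charted R (n + 1))
    (gamma1 gamma2 : R -> sphere R n -> cosphere M) (t0 : R) (e : int) : Prop :=
  exists s1 s2, crossing_at gamma1 gamma2 t0 e s1 s2.

Definition path_in (R : realType) n (M : charted R (n + 1))
    (P : (sphere R n -> cosphere M) -> Prop) (a b : R)
    (gamma1 gamma2 : R -> sphere R n -> cosphere M) : Prop :=
  [/\ smooth_path a b gamma1, smooth_path a b gamma2
    & forall t, a <= t <= b -> P (gamma1 t) /\ P (gamma2 t)].

(* A generic path in S x S over [a, b] with endpoints off Sigma; ts lists its
   crossing times with their signs. *)
Definition generic_path (R : realType) n (M : charted R (n + 1))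
    (eps : M -> sphere R n -> cosphere M) (a b : R)
    (gamma1 gamma2 : R -> sphere R n -> cosphere M) (ts : seq (R * int)) :
    Prop :=
  [/\ a < b, path_in (spaceS eps) a b gamma1 gamma2,
      uniq (map fst ts),
      forall t, a <= t <= b ->
        (Sigma (gamma1 t) (gamma2 t) <-> t \in map fst ts)
    & forall te, te \in ts ->
        a < te.1 < b /\ crossing gamma1 gamma2 te.1 te.2].

(** * The group A(M) *)

(* A(M) = Omega_0(B) / Indet, where B is the space of the (phi1, phi2, s1, s2)
   with phi1, phi2 in S and phi1 s1 = phi2 s2, and Indet is generated by the
   images of the pairings mu_{0,1} and mu_{1,0}.
   Omega_0(B) is identified with Z by the augmentation, as B is path
   connected.  The class mu([alpha], [phi]) is then the number of points of V,
   counted with signs.  A closed oriented 1-manifold is a disjoint union of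
   circles, so Omega_1(S) is generated by loops, given here as 1-periodic
   maps, and Omega_0(S) by points. *)
Definition smooth_loop (R : realType) n (M : charted R (n + 1))
    (eps : M -> sphere R n -> cosphere M)
    (alpha : R -> sphere R n -> cosphere M) : Prop :=
  [/\ smooth_map [set tx : R * 'rV[R]_(n + 1) | tx.2 != 0]
        (fun tx => alpha tx.1 (sph_proj tx.2)),
      forall t, alpha (t + 1) = alpha t
    & forall t, spaceS eps (alpha t)].

(* The sign of a point (t, s1, s2) of V: alpha (t, s1) = phi s2.  As a sign
   convention, the orientation of V as the transverse preimage of the diagonal
   differs from this one by a sign depending only on n, and hence generates the
   same subgroup. *)
Definition mu_sign (R : realType) n (M : charted R (n + 1))
    (alpha : R -> sphere R n -> cosphere M) (phi : sphere R n -> cosphere M)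
    (p : R * sphere R n * sphere R n) (e : int) : Prop :=
  let: (t, s1, s2) := p in
  (e = 1 \/ e = -1) /\
  forall (C : chart (cosphere M)) r1 r2, cdom C (alpha t s1) ->
    pos_frame s1 r1 -> pos_frame s2 r2 ->
    0 < e%:~R * res_det C (alpha t) phi s1 s2 r1 r2
                  ('D_1 (fun u : R => cmap C (alpha u s1)) t).

(* mu_{1,0}([alpha], [phi]) = k, for alpha and phi with transverse adjoints:
   V lists the points of the fibre product, with their signs.  (Each point has
   a sign exactly when the adjoints are transverse.) *)
Definition mu10 (R : realType) n (M : charted R (n + 1))
    (alpha : R -> sphere R n -> cosphere M) (phi : sphere R n -> cosphere M)
    (k : int) : Prop :=
  exists V : seq (R * sphere R n * sphere R n * int),
    [/\ uniq (map fst V),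
        forall t s1 s2, ((t, s1, s2) \in map fst V) <->
          (0 <= t < 1 /\ alpha t s1 = phi s2),
        forall pe, pe \in V -> mu_sign alpha phi pe.1 pe.2
      & k = \sum_(pe <- V) pe.2].

(* mu_{0,1}([phi], [alpha]) is, up to a sign depending only on n,
   mu_{1,0}([alpha], [phi]). *)
Definition indet_generator (R : realType) n (M : charted R (n + 1))
    (eps : M -> sphere R n -> cosphere M) (k : int) : Prop :=
  exists alpha phi, [/\ smooth_loop eps alpha, spaceS eps phi
                      & mu10 alpha phi k].

Definition Indet (R : realType) n (M : charted R (n + 1))
    (eps : M -> sphere R n -> cosphere M) (k : int) : Prop :=
  forall H : int -> Prop,
    H 0 -> (forall x y, H x -> H y -> H (x - y)) ->
    (forall g, indet_generator eps g -> H g) -> H k.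

(* (A, q) is the quotient group Omega_0(B) / Indet with its projection. *)
Definition is_quotient_by_Indet (R : realType) n (M : charted R (n + 1))
    (eps : M -> sphere R n -> cosphere M) (A : zmodType)
    (q : {additive int -> A}) : Prop :=
  (forall x, exists k, q k = x) /\ (forall k, q k = 0 <-> Indet eps k).

(* Values on Sigma are irrelevant. *)
Record is_alk (R : realType) n (M : charted R (n + 1))
    (eps : M -> sphere R n -> cosphere M) (A : zmodType)
    (q : {additive int -> A})
    (alk : (sphere R n -> cosphere M) -> (sphere R n -> cosphere M) -> A) :
    Prop := {
  alk_locally_constant : forall a b gamma1 gamma2, a < b ->
    path_in (spaceS eps) a b gamma1 gamma2 ->
    (forall t, a <= t <= b -> ~ Sigma (gamma1 t) (gamma2 t)) ->
    alk (gamma1 a) (gamma2 a) = alk (gamma1 b) (gamma2 b);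
  alk_jump : forall a b gamma1 gamma2 ts,
    generic_path eps a b gamma1 gamma2 ts ->
    alk (gamma1 b) (gamma2 b) - alk (gamma1 a) (gamma2 a)
      = q (\sum_(te <- ts) te.2);
  alk_normalized : forall u v, u <> v -> alk (eps u) (eps v) = 0 }.

(** * Dangerous tangencies *)

(* Equality of points of ST^*M says that the covectors defining the two lifts
   are positive multiples of each other; in particular the branches are
   tangent. *)
Definition dangerous_tangency (R : realType) n (M : charted R (n + 1))
    (phi1 phi2 : sphere R n -> cosphere M) (s1 s2 : sphere R n) : Prop :=
  [/\ regular_at (front phi1) s1 /\ regular_at (front phi2) s2,
      phi1 s1 = phi2 s2,
      forall u1 u2, phi1 u1 = phi2 u2 -> u1 = s1 /\ u2 = s2,
      forall u, front phi1 u = front phi1 s1 -> u = s1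
    & forall u, front phi2 u = front phi2 s2 -> u = s2].

(* z is the direction of the normal vector v, given in the chart c: the
   covector g(v, .) is in the ray z. *)
Definition has_normal (R : realType) n (M : charted R (n + 1))
    (g : metric_data M) (z : cosphere M) (c : chart M) (v : 'rV[R]_(n + 1)) :
    Prop :=
  ray z c (v *m g c (cmap c (base z))).

(* x = (hcoord x, vcoord x), with vcoord x the last coordinate x_m. *)
Definition hcoord (R : realType) n (x : 'rV[R]_(n + 1)) : 'rV[R]_n := lsubmx x.
Definition vcoord (R : realType) n (x : 'rV[R]_(n + 1)) : R := rsubmx x 0 0.
Definition vbasis_last (R : realType) n : 'rV[R]_(n + 1) := row_mx 0 1.

(* In the chart c, the branch at s of the front of phi is the graph
   x_m = f (x_1, .., x_(m-1)) near the origin. *)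
Definition branch_is_graph (R : realType) n (M : charted R (n + 1))
    (c : chart M) (phi : sphere R n -> cosphere M) (s : sphere R n)
    (f : 'rV[R]_n -> R) : Prop :=
  (exists U : set 'rV[R]_n, [/\ open U, U 0 & Cinf U f]) /\
  \forall x \near val s,
    vcoord (cmap c (front phi (sph_proj x)))
      = f (hcoord (cmap c (front phi (sph_proj x)))).

Definition hessian (R : realType) n (f : 'rV[R]_n -> R) (x : 'rV[R]_n) :
    'M[R]_n :=
  \matrix_(i < n, j < n)
    'D_(delta_mx 0 i) (fun y => 'D_(delta_mx 0 j) f y) x.

(* Eigenvalues are counted with multiplicity. *)
Definition num_neg_eigenvalues (R : realType) n (H : 'M[R]_n) : nat :=
  \sum_(a \in [set a : R | a < 0 /\ eigenvalue H a]) mup a (char_poly H).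

(* The orientations of the branches at s1 and s2 agree. *)
Definition same_orientation (R : realType) n (M : charted R (n + 1))
    (c : chart M) (phi1 phi2 : sphere R n -> cosphere M) (s1 s2 : sphere R n) :
    Prop :=
  forall r1 r2, pos_frame s1 r1 -> pos_frame s2 r2 ->
  exists P : 'M[R]_n, 0 < \det P /\
    sph_diff_frame c (front phi2) s2 r2 = P *m sph_diff_frame c (front phi1) s1 r1.

(* For t > t0 close to t0, u t is the point of the branch at s of the front of
   gamma t that projects to the origin of the (x_1, .., x_(m-1))-hyperplane. *)
Definition point_over_origin (R : realType) n (M : charted R (n + 1))
    (c : chart M) (gamma : R -> sphere R n -> cosphere M) (t0 : R)
    (s : sphere R n) (u : R -> sphere R n) : Prop :=
  (fun t => val (u t)) @ t0^'+ --> val s /\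
  \forall t \near t0^'+, cdom c (front (gamma t) (u t)) /\
    hcoord (cmap c (front (gamma t) (u t))) = 0.

Definition height_sign_after (R : realType) n (M : charted R (n + 1))
    (c : chart M) (gamma1 gamma2 : R -> sphere R n -> cosphere M) (t0 : R)
    (s1 s2 : sphere R n) (alpha : int) : Prop :=
  exists u1 u2 : R -> sphere R n,
    let h1 t := vcoord (cmap c (front (gamma1 t) (u1 t))) in
    let h2 t := vcoord (cmap c (front (gamma2 t) (u2 t))) in
    [/\ point_over_origin c gamma1 t0 s1 u1, point_over_origin c gamma2 t0 s2 u2
      & (alpha = 1 /\ \forall t \near t0^'+, h2 t < h1 t) \/
        (alpha = -1 /\ \forall t \near t0^'+, h1 t < h2 t)].

(* Main.v *)
Require Import Defs.
From HB Require Import structures.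
From mathcomp Require Import all_boot all_order all_algebra.
From mathcomp Require Import all_classical all_reals all_analysis.
From mathcomp Require Import polyrcf ring.
Set Implicit Arguments.
Unset Strict Implicit.
Unset Printing Implicit Defensive.
Import Order.TTheory GRing.Theory Num.Theory.
Import numFieldNormedType.Exports.
Local Open Scope classical_set_scope.
Local Open Scope ring_scope.

(** The path crosses the discriminant once, with some sign e, so the increment
of alk is q e, and only the sign of one determinant has to be computed.

Near the tangency the fronts are the graphs x_m = f_i(x'), and the Legendrian
condition says that the lift of such a graph is the ray of (grad f_i, -1): the
whole lift is determined by the 1-jet of f_i ([lift_ray]). In the chart of
ST^*M whose fibre coordinates are grad f_i, up to a reflection that makes the
chart positive, the differential of the i-th branch in a frame of the sphere is
therefore X_i (1, p^T, H_i D), where X_i is the invertible matrix of the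
horizontal velocities, p the common gradient at the origin, H_i the Hessian of
f_i and D the reflection ([lift_frame]). Row and column operations turn the
determinant of the frame (branch 1, w, branch 2) into
  - det X_1 det X_2 det (H_2 - H_1) (w_m - w' . p)  ([det_jet_frame]),
the sign in front being det D.

The four factors are the four ingredients of the formula. The product det X_1
det X_2 is positive exactly when the branches are equally oriented, which is
epsilon ([front_frame]). The sign of det (H_2 - H_1) is (-1)^sigma; this holds
for every real matrix with nonzero determinant, because the characteristic
polynomial divided by its negative linear factors keeps a constant sign on the
negative axis ([sign_det_num_neg_eigenvalues]). Finally w_m - w' . p is the
rate at which the height of the second front over the origin overtakes that of
the first: x_m - f_i(x') vanishes along the branch at time t0, so the mean
value theorem in t gives its first order behaviour along any curve of points of
the sphere that converges to the tangency, without solving for the point over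
the origin ([slope_along_curve], [branch_height]). Hence it has the sign of -
alpha.

Since the sign of the crossing does not depend on the positive frames, neither
does that of det X_1 det X_2, and both cases of epsilon follow without
comparing frames. *)

(** * Negative eigenvalues and the sign of the determinant *)

(** The sign of p at 0 is its sign at -oo, because it cannot change on the way;
  substituting -X turns -oo into +oo, where the leading coefficient decides. *)
Lemma poly_no_neg_root (R : rcfType) (p : {poly R}) :
  p \is monic -> (forall x, x <= 0 -> ~~ root p x) ->
  0 < (-1) ^+ (size p).-1 * p.[0].
Proof.
move=> pm pnr; pose r := (-1) ^+ (size p).-1 *: (p \Po (- 'X)).
have lr : lead_coef r = 1.
  rewrite lead_coefZ lead_coef_comp ?size_polyN ?size_polyX //.
  by rewrite (monicP pm) mul1r lead_coefN lead_coefX -expr2 sqrr_sign.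
have [b rb] : exists b, forall x, x >= b -> r.[x] >= lead_coef r.
  by apply: poly_pinfty_gt_lc; rewrite lr.
have r0 : r.[0] = (-1) ^+ (size p).-1 * p.[0].
  by rewrite hornerZ horner_comp hornerN hornerX oppr0.
rewrite -r0 ltNge; apply/negP => r0le.
have b0 : 0 <= Num.max 0 b by rewrite le_max lexx.
have rm : 0 < r.[Num.max 0 b].
  by apply: lt_le_trans (rb _ _); rewrite ?lr ?ltr01 // le_max lexx orbT.
have [|x xI] := @polyrcf.poly_ivt R r _ _ b0.
  by rewrite pmulr_lle0.
rewrite rootE hornerZ horner_comp hornerN hornerX mulf_eq0 signr_eq0 /=.
apply/negP; rewrite -rootE; apply: pnr.
by rewrite oppr_le0 (itvP xI).
Qed.

(** Divide p by (X - a)^m for each negative root a of multiplicity m: every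
  such factor is positive at 0, and the quotient has no root on the negative
  axis. *)
Lemma sign_poly_at0 (R : rcfType) (p : {poly R}) :
  p \is monic -> p.[0] != 0 ->
  exists s : seq R, [/\ uniq s, forall x, x \in s = (x < 0) && root p x &
    0 < (-1) ^+ (\sum_(a <- s) mup a p + (size p).-1) * p.[0]].
Proof.
have [k] := ubnP (size p); elim: k p => // k IH p /ltnSE szp pm p0.
have pN0 : p != 0 by rewrite monic_neq0.
have [[a [a0 ra]]|nr] := pselect (exists a, a < 0 /\ root p a); last first.
  exists [::]; rewrite big_nil; split=> // [x|].
    by rewrite in_nil; apply/esym/negP => /andP[x0 rx]; apply: nr; exists x.
  rewrite add0n; apply: poly_no_neg_root => // x.
  rewrite le_eqVlt => /orP[/eqP->|x0]; first by rewrite rootE.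
  by apply/negP => rx; apply: nr; exists x.
have [m [r]] := multiplicity_XsubC p a; rewrite pN0 /= => ra0 pE.
have rm : r \is monic.
  by rewrite -(monicMr _ (monic_exp m (monicXsubC a))) -pE.
have rN0 : r != 0 by rewrite monic_neq0.
have XmN0 : ('X - a%:P) ^+ m != 0 by rewrite expf_neq0 // polyXsubC_eq0.
have szr : (size p).-1 = ((size r).-1 + m)%N.
  rewrite pE size_mul // size_exp_XsubC addnS /=.
  by rewrite -[in LHS](prednK (n := size r)) ?size_poly_gt0.
have m0 : (0 < m)%N.
  case: (posnP m) => // m0; move: ra; rewrite pE m0 expr0 mulr1.
  by rewrite (negPf ra0).
have p0E : p.[0] = r.[0] * (- a) ^+ m.
  by rewrite pE hornerM horner_exp !hornerE.
have r0 : r.[0] != 0 by move: p0; rewrite p0E mulf_eq0 negb_or => /andP[].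
have szlt : (size r < k)%N.
  apply: leq_trans szp; rewrite -[size r]prednK ?size_poly_gt0 //.
  rewrite -[X in (_ < X)%N]prednK ?size_poly_gt0 // ltnS szr.
  by rewrite -[X in (X < _)%N]addn0 ltn_add2l.
have [s [us sr spos]] := IH _ szlt rm r0.
have as_ : a \notin s by rewrite sr (negPf ra0) andbF.
exists (a :: s); split.
- by rewrite /= as_.
- move=> x; rewrite inE sr; have [->|xa] /= := eqVneq x a; first by rewrite a0 ra.
  congr (_ && _); rewrite pE rootM; case: (root r x) => //=.
  by rewrite rootE horner_exp !hornerE expf_eq0 subr_eq0 (negPf xa) andbF.
- rewrite big_cons.
  have -> : mup a p = m.
    by rewrite pE mupMr // mup_XsubCX eqxx.
  have -> : \sum_(j <- s) mup j p = \sum_(j <- s) mup j r.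
    apply: eq_big_seq => j; rewrite sr => /andP[_ rj].
    have ja : j != a by apply: contraTneq rj => ->.
    rewrite pE mupMl // rootE horner_exp !hornerE expf_eq0 subr_eq0 (negPf ja).
    by rewrite andbF.
  rewrite szr p0E.
  rewrite [((size r).-1 + m)%N]addnC addnACA.
  rewrite exprD addnn -mul2n exprM sqrrN !expr1n mul1r mulrA.
  by rewrite pmulr_lgt0 // exprn_gt0 // oppr_gt0.
Qed.

(** The characteristic polynomial takes the value (-1)^n det H at 0. In terms
  of eigenvalues: nonreal ones come in conjugate pairs, which contribute a
  positive factor to the determinant. *)
Lemma sign_det_num_neg_eigenvalues (R : realType) n (H : 'M[R]_n) :
  \det H != 0 -> 0 < (-1) ^+ num_neg_eigenvalues H * \det H.
Proof.
move=> dH; pose p := char_poly H.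
have p0E : p.[0] = (-1) ^+ n * \det H.
  by rewrite horner_coef0 char_poly_det.
have p0 : p.[0] != 0 by rewrite p0E mulf_eq0 signr_eq0.
have [s [us sE]] := sign_poly_at0 (char_poly_monic H) p0.
rewrite -/p p0E size_char_poly /= exprD mulrA -[_ * _ * _ ^+ n]mulrA.
rewrite -expr2 sqrr_sign mulr1; congr (0 < (-1) ^+ _ * _).
rewrite /num_neg_eigenvalues; apply/esym.
have -> : [set a : R | a < 0 /\ eigenvalue H a] = [set` s].
  apply/seteqP; split=> a /=; rewrite sE eigenvalue_root_char -/p.
    by move=> [-> ->].
  by move=> /andP[].
by rewrite -fsbig_seq.
Qed.

(** * Determinants of frames *)

(** The frame of two 1-jet lifts with the same 1-jet and a transverse vector w:
  subtracting the rows of the first branch from those of the second leaves K2 -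
  K1 in the last block, and clearing p^T leaves the component of w along the
  conormal (-p, 1). *)
Lemma det_jet_frame (R : comNzRingType) n (p : 'rV[R]_n) (K1 K2 : 'M[R]_n)
    (w : 'rV[R]_(n + 1 + n)) :
  \det (col_mx (col_mx (row_mx (row_mx 1%:M p^T) K1) w)
               (row_mx (row_mx 1%:M p^T) K2))
  = (rsubmx (lsubmx w) - lsubmx (lsubmx w) *m p^T) 0 0 * \det (K2 - K1).
Proof.
set wx := lsubmx (lsubmx w); set wm := rsubmx (lsubmx w); set wp := rsubmx w.
have -> : w = row_mx (row_mx wx wm) wp by rewrite !hsubmxK.
pose Q : 'M[R]_(n + 1) := block_mx 1%:M p^T wx wm.
pose E : 'M[R]_(n + 1 + n) := block_mx 1%:M 0 (row_mx (- 1%:M) 0) 1%:M.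
have detE B : \det B = \det (E *m B).
  by rewrite det_mulmx det_lblock !det1 !mul1r.
have detQ : \det Q = (wm - wx *m p^T) 0 0.
  pose L : 'M[R]_(n + 1) := block_mx 1%:M 0 (- wx) 1%:M.
  have -> : \det Q = \det (L *m Q) by rewrite det_mulmx det_lblock !det1 !mul1r.
  rewrite mulmx_block !mul1mx !mul0mx !addr0 mulmx1 addNr mulNmx [- _ + _]addrC.
  by rewrite det_ublock det1 mul1r det_mx11.
rewrite detE mul_block_col !mul1mx !mul0mx addr0.
rewrite mul_row_col mul0mx addr0 mulNmx mul1mx opp_row_mx !add_row_mx !addNr.
have -> : col_mx (row_mx (row_mx 1%:M p^T) K1) (row_mx (row_mx wx wm) wp)
    = row_mx Q (col_mx K1 wp).
  by rewrite -[LHS]block_mxEv block_mxEh.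
by rewrite -[col_mx _ _]block_mxEv det_ublock detQ [- K1 + _]addrC.
Qed.

Lemma det_col_mx_frames (R : comNzRingType) n (X1 X2 : 'M[R]_n)
    (F1 F2 : 'M[R]_(n, n + 1 + n)) (w : 'rV[R]_(n + 1 + n)) :
  \det (col_mx (col_mx (X1 *m F1) w) (X2 *m F2))
    = \det X1 * \det X2 * \det (col_mx (col_mx F1 w) F2).
Proof.
have -> : col_mx (col_mx (X1 *m F1) w) (X2 *m F2)
    = block_mx (block_mx X1 0 0 1%:M) 0 0 X2 *m col_mx (col_mx F1 w) F2.
  by rewrite !mul_block_col !mul0mx !addr0 !add0r mul1mx.
by rewrite det_mulmx !det_ublock det1 mulr1.
Qed.

(** Covectors with negative last coordinate are normalized by the matrix -1;
  the charts of the cosphere bundle ask for a positive determinant, which a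
  reflection of the other coordinates restores. *)
Definition reflection_mx (R : nzRingType) n : 'M[R]_n :=
  diag_mx (\row_(i < n) (if i == 0%N :> nat then -1 else 1)).

Lemma det_reflection_mx (R : comNzRingType) n :
  (0 < n)%N -> \det (reflection_mx R n) = -1.
Proof.
case: n => // n _; rewrite det_diag big_ord_recl big1 ?mulr1 => [|i _].
  by rewrite mxE.
by rewrite mxE.
Qed.

Lemma reflection_mxK (R : comNzRingType) n :
  reflection_mx R n *m reflection_mx R n = 1%:M.
Proof.
rewrite /reflection_mx mulmx_diag -diag_const_mx; congr diag_mx.
by apply/rowP => i; rewrite !mxE; case: ifP; rewrite ?mulrNN mulr1.
Qed.

(** A basis of the orthogonal complement of s, with one vector reversed if it
  is negative. *)
Lemma exists_pos_frame (R : realType) n (hn : (0 < n)%N) (s : sphere R n) :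
  exists r, pos_frame s r.
Proof.
set v : 'rV[R]_(n + 1) := val s.
have vv : v *m v^T = 1%:M.
  rewrite [LHS]mx11_scalar mxE; congr (_%:M); rewrite -[RHS](eqP (valP s)).
  by apply: eq_bigr => i _; rewrite mxE expr2.
have v0 : v^T != 0.
  by apply/eqP => v0; move: vv; rewrite v0 mulmx0 => /matrixP/(_ 0 0)/eqP;
    rewrite !mxE eqxx eq_sym oner_eq0.
have rk : \rank (kermx v^T) = n.
  by rewrite mxrank_ker mxrank_tr rank_rV -[v]trmxK trmx_eq0 v0 addnK.
have [r [rf rv]] : exists r : 'M[R]_(n, n + 1), row_free r /\ r *m v^T = 0.
  have : row_base (kermx v^T) *m v^T = 0.
    by apply/sub_kermxP; rewrite eq_row_base.
  move: (row_base_free (kermx v^T)); move: (row_base _); rewrite rk => r rf rv.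
  by exists r.
have dN0 : \det (col_mx r v) != 0.
  rewrite -unitfE -[_ \is a _]unitmxE -row_free_unit; apply/row_freeP.
  have [r' rr'] := row_freeP rf.
  (* a right inverse of r, projected orthogonally to v, and v^T itself *)
  exists (row_mx ((1%:M - v^T *m v) *m r') v^T).
  rewrite mul_col_row !mulmxA !mulmxBr !mulmx1 !mulmxA rv vv !mul0mx mul1mx.
  by rewrite subr0 subrr mul0mx rr' -scalar_mx_block.
have [dpos|] := ltP 0 (\det (col_mx r v)); first by exists r.
rewrite le_eqVlt (negPf dN0) /= => dneg.
pose N := reflection_mx R n.
exists (N *m r); split; first by rewrite -mulmxA rv mulmx0.
have -> : col_mx (N *m r) (val s) = block_mx N 0 0 1%:M *m col_mx r v.
  by rewrite mul_block_col !mul0mx addr0 add0r mul1mx.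
by rewrite det_mulmx det_ublock det1 det_reflection_mx // mulr1 mulN1r oppr_gt0.
Qed.

(** * Maps of class C^1 between normed spaces *)

Lemma Cinf_differentiable (R : realType) (V W : normedModType R) (U : set V)
    (f : V -> W) x : Cinf U f -> U x -> differentiable f x.
Proof. by move=> /(_ 1%N)[fd _]; exact: fd. Qed.

Lemma Cinf_derive (R : realType) (V W : normedModType R) (U : set V)
    (f : V -> W) v : Cinf U f -> Cinf U ('D_v f).
Proof. by move=> fC k; have [_] := fC k.+1; exact. Qed.

Lemma Cinf_continuous (R : realType) (V W : normedModType R) (U : set V)
    (f : V -> W) x : Cinf U f -> U x -> {for x, continuous f}.
Proof. by move=> /(_ 0%N); exact. Qed.

Lemma near_near (R : realType) (V : normedModType R) (x : V) (P : set V) :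
  (\forall y \near x, P y) -> \forall y \near x, \forall z \near y, P z.
Proof. exact: nbhs_interior. Qed.

(** Differentiability is asked on a neighbourhood so that the mean value
  theorem applies there. *)
Definition C1_near (R : realType) (V W : normedModType R) (f : V -> W) (x : V) :=
  \forall y \near x, differentiable f y /\ forall v, {for y, continuous ('D_v f)}.

Lemma Cinf_C1_near (R : realType) (V W : normedModType R) (U : set V)
    (f : V -> W) x : open U -> U x -> Cinf U f -> C1_near f x.
Proof.
move=> Uo Ux fC; have : \forall y \near x, U y by exact: open_nbhs_nbhs.
apply: filterS => y Uy; split; first exact: Cinf_differentiable fC Uy.
by move=> v; apply: (Cinf_continuous (Cinf_derive v fC)).
Qed.

Lemma C1_near_differentiable (R : realType) (V W : normedModType R)
    (f : V -> W) x : C1_near f x -> differentiable f x.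
Proof. by move=> /nbhs_singleton[]. Qed.

Lemma C1_near_continuous (R : realType) (V W : normedModType R)
    (f : V -> W) x : C1_near f x -> {for x, continuous f}.
Proof. by move=> /C1_near_differentiable/differentiable_continuous. Qed.

Lemma near_eq_continuous_for (T U : topologicalType) (f g : T -> U) x :
  (\near x, f x = g x) -> {for x, continuous f} -> {for x, continuous g}.
Proof.
move=> fg fc; rewrite /prop_for /continuous_at -(nbhs_singleton fg).
by apply: cvg_trans fc; apply: near_eq_cvg; apply: filterS fg => y ->.
Qed.

(** The difference vanishes near x, so its differential at x is 0. *)
Lemma differentiable_near_eq (R : realType) (V W : normedModType R)
    (f g : V -> W) x :
  (\near x, f x = g x) -> differentiable f x -> differentiable g x.
Proof.
move=> fg fd; pose h := g - f; suff hd : differentiable h x.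
  have -> : g = h + f by rewrite /h subrK.
  exact: differentiableD.
have h0 : h \o shift x = cst (h x) + \0 +o_ 0 id.
  apply/eqaddoP => _/posnumP[e].
  have : \forall y \near 0, f (y + x) = g (y + x).
    move: fg; rewrite (near_shift 0 x); apply: filterS => y /=.
    by rewrite subr0.
  apply: filterS => y fgy; rewrite !fctE /h !fctE /= -fgy (nbhs_singleton fg).
  by rewrite !subrr addr0 subr0 normr0 mulr_ge0.
have d0 : 'd h x = \0 :> (V -> W).
  by apply: (@diff_unique _ _ _ h \0) => //; exact: cst_continuous.
by apply/diff_locallyP; rewrite d0; split=> //; exact: cst_continuous.
Qed.

Lemma differentiable_rV (R : realType) (V : normedModType R) d
    (f : V -> 'rV[R]_d) x :
  (forall j, differentiable (fun y => f y 0 j) x) -> differentiable f x.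
Proof.
move=> fj; have -> : f = \sum_(j < d) (fun y => f y 0 j *: delta_mx 0 j).
  by apply/funext => y; rewrite fct_sumE -row_sum_delta.
by apply: differentiable_sum => j; exact: (differentiableZl _ (fj j)).
Qed.

Lemma differentiable_entry (R : realType) (V : normedModType R) m d
    (f : V -> 'M[R]_(m, d)) x i j :
  differentiable f x -> differentiable (fun y => f y i j) x.
Proof.
move=> fd; apply: (@differentiable_comp _ _ _ _ f (fun N => N i j)) => //.
exact: differentiable_coord.
Qed.

Lemma differentiable_sumr (R : realType) (V : normedModType R) d
    (f : 'I_d -> V -> R) x : (forall i, differentiable (f i) x) ->
  differentiable (fun y => \sum_(i < d) f i y) x.
Proof.
move=> fd; have -> : (fun y => \sum_(i < d) f i y) = \sum_(i < d) f i.
  by apply/funext => y; rewrite fct_sumE.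
exact: differentiable_sum.
Qed.

Lemma differentiable_mulmxr (R : realType) (V : normedModType R) d e
    (f : V -> 'rV[R]_d) (A : 'M[R]_(d, e)) x :
  differentiable f x -> differentiable (fun y => f y *m A) x.
Proof.
move=> fd; apply: differentiable_rV => j.
under eq_fun do rewrite mxE; apply: differentiable_sumr => i.
apply: differentiableM; [exact: differentiable_entry | exact: differentiable_cst].
Qed.

Lemma differentiable_row_mx (R : realType) (V : normedModType R) d e
    (f : V -> 'rV[R]_d) (g : V -> 'rV[R]_e) x :
  differentiable f x -> differentiable g x ->
  differentiable (fun y => row_mx (f y) (g y)) x.
Proof.
move=> fd gd; apply: differentiable_rV => j; rewrite -(splitK j).
case: (fintype.split j) => k /=.
  under eq_fun do rewrite row_mxEl; exact: differentiable_entry.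
under eq_fun do rewrite row_mxEr; exact: differentiable_entry.
Qed.

Lemma derive_linear (R : realType) (V V' W : normedModType R) (f : V -> V')
    (L : {linear V' -> W}) x v :
  continuous L -> differentiable f x -> 'D_v (L \o f) x = L ('D_v f x).
Proof.
move=> Lc fd; have Ld : differentiable L (f x) by exact: linear_differentiable.
rewrite (deriveE v (differentiable_comp fd Ld)) (deriveE v fd).
by rewrite (diff_comp fd Ld) /= (diff_lin _ Lc).
Qed.

Lemma continuous_mulmxr (R : realType) d e (A : 'M[R]_(d, e)) :
  continuous (mulmxr A : 'rV[R]_d -> 'rV[R]_e).
Proof.
by move=> x; apply/differentiable_continuous/differentiable_mulmxr;
  exact: ex_diff.
Qed.

Lemma derive_entry (R : realType) (V : normedModType R) m d
    (f : V -> 'M[R]_(m, d)) x v i j :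
  differentiable f x -> 'D_v (fun y => f y i j) x = 'D_v f x i j.
Proof. by move=> fd; rewrite derive_mx ?mxE //; exact: diff_derivable. Qed.

Lemma derive_comp_rV (R : realType) (V W : normedModType R) d
    (f : V -> 'rV[R]_d) (g : 'rV[R]_d -> W) x v :
  differentiable f x -> differentiable g (f x) ->
  'D_v (g \o f) x = \sum_(i < d) 'D_v f x 0 i *: 'D_(delta_mx 0 i) g (f x).
Proof.
move=> fd gd; rewrite deriveE; last exact: differentiable_comp.
rewrite (diff_comp fd gd) /= -(deriveE v fd).
rewrite {1}(row_sum_delta ('D_v f x)) linear_sum /=.
by apply: eq_bigr => i _; rewrite linearZ /= (deriveE _ gd).
Qed.

(** The directional derivatives of the composite are the finite sums given by
  the chain rule, so their continuity reduces to that of the partial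
  derivatives of g. *)
Lemma C1_near_comp (R : realType) (V W : normedModType R) d
    (f : V -> 'rV[R]_d) (g : 'rV[R]_d -> W) x :
  C1_near f x -> C1_near g (f x) -> C1_near (g \o f) x.
Proof.
move=> fC gC; have fc : f @ x --> f x := C1_near_continuous fC.
have {}gC : \forall y \near x, differentiable g (f y) /\
  forall v, {for f y, continuous ('D_v g)} by exact: (fc _ gC).
have fgC : \forall y \near x, (differentiable f y /\
    forall v, {for y, continuous ('D_v f)}) /\ (differentiable g (f y) /\
    forall v, {for f y, continuous ('D_v g)}).
  exact: (@filterI _ (nbhs x) _ _ _ fC gC).
apply: filterS (near_near fgC) => y yI.
have [[fdy fcy] [gdy gcy]] := nbhs_singleton yI.
split; first exact: differentiable_comp.
move=> v; pose h z := \sum_(i < d) 'D_v f z 0 i *: 'D_(delta_mx 0 i) g (f z).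
apply: (@near_eq_continuous_for _ _ h).
  by apply: filterS yI => z [[fdz _] [gdz _]]; rewrite /h -derive_comp_rV.
rewrite /prop_for /continuous_at /h.
apply: cvg_big => [|i _]; first exact: add_continuous.
apply: cvgZ.
  have fv : 'D_v f z @[z --> y] --> 'D_v f y := fcy v.
  exact: (cvg_comp _ _ fv (@coord_continuous _ _ _ _ _ _)).
have fy : f z @[z --> y] --> f y := differentiable_continuous fdy.
exact: (cvg_comp _ _ fy (gcy _)).
Qed.

Lemma C1_near_linear (R : realType) (V V' W : normedModType R) (f : V -> V')
    (L : {linear V' -> W}) x : continuous L -> C1_near f x -> C1_near (L \o f) x.
Proof.
move=> Lc fC; apply: filterS (near_near fC) => y yI.
have [fdy fcy] := nbhs_singleton yI.
split; first by apply: differentiable_comp => //; exact: linear_differentiable.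
move=> v; apply: (@near_eq_continuous_for _ _ (L \o 'D_v f)).
  by apply: filterS yI => z [fdz _] /=; rewrite derive_linear.
have fv : 'D_v f z @[z --> y] --> 'D_v f y := fcy v.
exact: (cvg_comp _ _ fv (Lc _)).
Qed.

Lemma C1_near_eq (R : realType) (V W : normedModType R) (f g : V -> W) x :
  (\near x, f x = g x) -> C1_near f x -> C1_near g x.
Proof.
move=> fg fC; apply: filterS2 fC (near_near (near_near fg)) => y [fd fc] yE.
split; first exact: (differentiable_near_eq (nbhs_singleton yE) fd).
move=> v; apply: near_eq_continuous_for (fc v).
by apply: filterS yE => z zE; exact: (near_eq_derive v zE).
Qed.

Lemma jacobian_entry (R : realType) k l (f : 'rV[R]_k -> 'rV[R]_l) x i j :
  differentiable f x -> jacobian f x i j = 'D_(delta_mx 0 i) f x 0 j.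
Proof. by move=> fd; rewrite (deriveEjacobian _ fd) -rowE [RHS]mxE. Qed.

Lemma derive_row_mx (R : realType) (V : normedModType R) d e
    (f : V -> 'rV[R]_d) (g : V -> 'rV[R]_e) x v :
  differentiable f x -> differentiable g x ->
  'D_v (fun y => row_mx (f y) (g y)) x = row_mx ('D_v f x) ('D_v g x).
Proof.
move=> fd gd; have hd := differentiable_row_mx fd gd.
rewrite -[LHS]hsubmxK.
rewrite -(derive_linear v (@continuous_lsubmx _ 1 d e) hd).
rewrite -(derive_linear v (@continuous_rsubmx _ 1 d e) hd).
by congr row_mx; congr ('D_v _ x); apply/funext => y /=; rewrite ?row_mxKl ?row_mxKr.
Qed.

Lemma derive_mulmxr (R : realType) (V : normedModType R) d e
    (f : V -> 'rV[R]_d) (A : 'M[R]_(d, e)) x v :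
  differentiable f x -> 'D_v (fun y => f y *m A) x = 'D_v f x *m A.
Proof. by move=> fd; exact: (derive_linear v (@continuous_mulmxr _ _ _ A) fd). Qed.

Lemma cvg_det (R : realType) (T : Type) (F : set_system T) (FF : Filter F) n
    (A : T -> 'M[R]_n) (B : 'M[R]_n) :
  (forall i j, A t i j @[t --> F] --> B i j) -> \det (A t) @[t --> F] --> \det B.
Proof.
move=> AB; apply: cvg_big => [|s _]; first exact: add_continuous.
apply: cvgZl_tmp; apply: cvg_big => [|i _]; first exact: mul_continuous.
exact: AB.
Qed.

Definition gradient (R : realType) n (f : 'rV[R]_n -> R) (x : 'rV[R]_n) :=
  \row_(i < n) 'D_(delta_mx 0 i) f x.

Lemma derive_comp_gradient (R : realType) (V : normedModType R) n
    (f : V -> 'rV[R]_n) (g : 'rV[R]_n -> R) x v :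
  differentiable f x -> differentiable g (f x) ->
  'D_v (g \o f) x = ('D_v f x *m (gradient g (f x))^T) 0 0.
Proof.
move=> fd gd; rewrite derive_comp_rV // mxE; apply: eq_bigr => i _.
by rewrite !mxE.
Qed.

Lemma differentiable_gradient (R : realType) n (U : set 'rV[R]_n)
    (f : 'rV[R]_n -> R) x : Cinf U f -> U x -> differentiable (gradient f) x.
Proof.
move=> fC Ux; apply: differentiable_rV => i; under eq_fun do rewrite mxE.
exact: (Cinf_differentiable (Cinf_derive _ fC) Ux).
Qed.

Lemma jacobian_gradient (R : realType) n (U : set 'rV[R]_n)
    (f : 'rV[R]_n -> R) x : Cinf U f -> U x ->
  jacobian (gradient f) x = hessian f x.
Proof.
move=> fC Ux; have gd := differentiable_gradient fC Ux.
apply/matrixP => i j; rewrite jacobian_entry // [RHS]mxE -(derive_entry _ _ _ gd).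
suff -> : (fun y => gradient f y 0 j) = 'D_(delta_mx 0 j) f by [].
by apply/funext => y; rewrite mxE.
Qed.

Lemma C1_near_sub (R : realType) (V W : normedModType R) (f g : V -> W) x :
  C1_near f x -> C1_near g x -> C1_near (fun y => f y - g y) x.
Proof.
move=> fC gC.
have fgC : \forall y \near x, (differentiable f y /\
    forall v, {for y, continuous ('D_v f)}) /\ (differentiable g y /\
    forall v, {for y, continuous ('D_v g)}).
  exact: (@filterI _ (nbhs x) _ _ _ fC gC).
apply: filterS (near_near fgC) => y yI.
have [[fd fc] [gd gc]] := nbhs_singleton yI; split; first exact: differentiableB.
move=> v; apply: (@near_eq_continuous_for _ _ (fun z => 'D_v f z - 'D_v g z)).
  apply: filterS yI => z [[fdz _] [gdz _]].
  exact: (esym (deriveB (diff_derivable fdz) (diff_derivable gdz))).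
by have := cvgB (fc v : _ --> _) (gc v : _ --> _); apply.
Qed.

Lemma derive_lsubmx (R : realType) (V : normedModType R) d e
    (f : V -> 'rV[R]_(d + e)) x v :
  differentiable f x -> 'D_v (fun y => lsubmx (f y)) x = lsubmx ('D_v f x).
Proof. by move=> fd; exact: (derive_linear v (@continuous_lsubmx _ _ _ _) fd). Qed.

Lemma differentiable_vcoord (R : realType) (V : normedModType R) n
    (f : V -> 'rV[R]_(n + 1)) x :
  differentiable f x -> differentiable (fun y => vcoord (f y)) x.
Proof.
move=> fd; apply: differentiable_entry.
exact: (@differentiable_comp _ _ _ _ f rsubmx _ fd (differentiable_rsubmx _)).
Qed.

Lemma derive_vcoord (R : realType) (V : normedModType R) n
    (f : V -> 'rV[R]_(n + 1)) x v :
  differentiable f x -> 'D_v (fun y => vcoord (f y)) x = vcoord ('D_v f x).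
Proof.
move=> fd.
have rd := @differentiable_comp _ _ _ _ f rsubmx _ fd (differentiable_rsubmx _).
rewrite /vcoord (derive_entry _ _ _ rd).
by rewrite (derive_linear v (@continuous_rsubmx _ _ _ _) fd).
Qed.

Lemma C1_near_cst_derive (R : realType) (V W : normedModType R) (f d : V -> W) x :
  (forall y, differentiable f y) -> (forall v y, 'D_v f y = d v) -> C1_near f x.
Proof.
move=> fd fD; apply: filterE => y; split; first exact: fd.
by move=> v; have -> : 'D_v f = cst (d v) by [apply/funext => z; rewrite fD];
  exact: cst_continuous.
Qed.

Lemma hessianB (R : realType) n (U1 U2 : set 'rV[R]_n) (f1 f2 : 'rV[R]_n -> R) x :
  open U1 -> U1 x -> Cinf U1 f1 -> open U2 -> U2 x -> Cinf U2 f2 ->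
  hessian (fun y => f2 y - f1 y) x = hessian f2 x - hessian f1 x.
Proof.
move=> U1o U1x f1C U2o U2x f2C; apply/matrixP => i j; rewrite !mxE.
have U12 : \forall y \near x, U1 y /\ U2 y.
  by apply: (@filterI _ (nbhs x)); exact: open_nbhs_nbhs.
have d1 := Cinf_differentiable (Cinf_derive (delta_mx 0 j) f1C) U1x.
have d2 := Cinf_differentiable (Cinf_derive (delta_mx 0 j) f2C) U2x.
apply: etrans _ (deriveB (diff_derivable d2) (diff_derivable d1)).
apply: near_eq_derive; apply: filterS U12 => y [U1y U2y].
by apply: deriveB; apply: diff_derivable; [exact: Cinf_differentiable f2C U2y
  | exact: Cinf_differentiable f1C U1y].
Qed.

(** A one-sided difference quotient written with the time t instead of the
  increment. *)
Lemma right_slope (R : realType) (W : normedModType R) (w : R -> W) (t0 : R) :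
  derivable w t0 1 -> w t0 = 0 ->
  (t - t0)^-1 *: w t @[t --> t0^'+] --> 'D_1 w t0.
Proof.
move=> wd w0.
have dc : (fun h : R => h^-1 *: ((w \o shift t0) (h *: 1) - w t0)) @ 0^'
    --> 'D_1 w t0 by exact: wd.
have sc : (t - t0) @[t --> t0^'+] --> (0 : R)^'.
  have c : (t - t0) @[t --> t0] --> (0 : R).
    by rewrite -(subrr t0); apply: cvgB; [exact: cvg_id | exact: cvg_cst].
  move=> P P0; have {}P0 : \forall h \near (0 : R), h != 0 -> P h by exact: P0.
  have Q : \forall t \near t0, t - t0 != 0 -> P (t - t0) by exact: (c _ P0).
  suff : \forall t \near t0^'+, P (t - t0) by [].
  near=> t; have t0t : t0 < t by near: t; exact: nbhs_right_gt.
  have Qt : t - t0 != 0 -> P (t - t0) by near: t; exact: cvg_within Q.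
  by apply: Qt; rewrite subr_eq0 gt_eqF.
have := cvg_comp _ _ sc dc; apply: cvg_trans; apply: near_eq_cvg.
by apply: filterE => t /=; rewrite w0 subr0 [_%:A]mulr1 subrK.
Unshelve. all: by end_near. Qed.

(** The pairing of v with the covector (-p, 1), the conormal of a graph with
  gradient p. *)
Definition conormal_part (R : realType) n (p : 'rV[R]_n) (v : 'rV[R]_(n + 1)) : R :=
  vcoord v - (hcoord v *m p^T) 0 0.

Lemma conormal_part_derive (R : realType) n (p : 'rV[R]_n)
    (v : R -> 'rV[R]_(n + 1)) t :
  differentiable v t ->
  is_derive t 1 (fun t => conormal_part p (v t)) (conormal_part p ('D_1 v t)).
Proof.
move=> vd; have hd : differentiable (fun t => hcoord (v t)) t.
  exact: (@differentiable_comp _ _ _ _ v lsubmx _ vd (differentiable_lsubmx _)).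
have hpd := differentiable_mulmxr p^T hd.
have d1 := differentiable_vcoord vd; have d2 := differentiable_entry 0 0 hpd.
apply: DeriveDef; first exact: (derivableB (diff_derivable d1) (diff_derivable d2)).
apply: etrans (deriveB (diff_derivable d1) (diff_derivable d2)) _.
by rewrite (derive_vcoord _ vd) (derive_entry _ _ _ hpd) (derive_mulmxr _ _ hd)
  (derive_lsubmx _ vd).
Qed.

Lemma conormal_partB (R : realType) n (p : 'rV[R]_n) (v w : 'rV[R]_(n + 1)) :
  conormal_part p (v - w) = conormal_part p v - conormal_part p w.
Proof.
rewrite /conormal_part /hcoord /vcoord !linearB /= mulmxBl mxE [in X in _ - X]mxE.
rewrite [(- rsubmx w) 0 0]mxE [(- (lsubmx w *m p^T)) 0 0]mxE.
by rewrite !opprD opprK addrACA.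
Qed.

(** * Transition maps of a manifold *)

Lemma jacobian_comp (R : realType) k l m (f : 'rV[R]_k -> 'rV[R]_l)
    (g : 'rV[R]_l -> 'rV[R]_m) (h : 'rV[R]_k -> 'rV[R]_m) x :
  differentiable f x -> differentiable g (f x) -> differentiable h x ->
  (\near x, h x = g (f x)) -> jacobian h x = jacobian f x *m jacobian g (f x).
Proof.
move=> fd gd hd hE; apply/row_matrixP => i; rewrite !rowE mulmxA.
rewrite -(deriveEjacobian _ hd) -(deriveEjacobian _ fd) -(deriveEjacobian _ gd).
rewrite (near_eq_derive _ hE) (deriveE _ gd) (deriveE _ fd).
by rewrite (deriveE _ (differentiable_comp fd gd)) (diff_comp fd gd).
Qed.

Section Manifold.
Variables (R : realType) (d : nat) (M : charted R d).
Hypothesis hM : oriented_manifold M.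
Implicit Types (c : chart M) (p : M).

Lemma transitionE c c' p :
  cdom c p -> cdom c' p -> transition c c' (cmap c p) = cmap c' p.
Proof.
move=> cp c'p; rewrite /transition /loc_rep.
have : [set y | exists q, [/\ cdom c q, cmap c q = cmap c p, cdom c' q &
    y = cmap c' q]] (cmap c' p) by exists p.
by move=> /getI[q [cq /(mfd_inj hM cq cp) -> _ ->]].
Qed.

Lemma transition_C1_near c c' p :
  cdom c p -> cdom c' p -> C1_near (transition c c') (cmap c p).
Proof.
move=> cp c'p; apply: Cinf_C1_near (@mfd_smooth _ _ _ hM c c'); last by exists p.
by have := @mfd_open _ _ _ hM c' c; rewrite setIC.
Qed.

Lemma transition_differentiable c c' p :
  cdom c p -> cdom c' p -> differentiable (transition c c') (cmap c p).
Proof. by move=> cp c'p; exact/C1_near_differentiable/transition_C1_near. Qed.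

Lemma transition_jac_cocycle (a b c : chart M) p :
  cdom a p -> cdom b p -> cdom c p ->
  transition_jac a c p = transition_jac a b p *m transition_jac b c p.
Proof.
move=> ap bp cp; rewrite /transition_jac -(transitionE ap bp).
apply: jacobian_comp; rewrite ?(transitionE ap bp).
- exact: transition_differentiable.
- exact: transition_differentiable.
- exact: transition_differentiable.
have oU := @mfd_open _ _ _ hM b a; have oU' := @mfd_open _ _ _ hM c a.
have U1 : \forall x \near cmap a p, (cmap a @` (cdom b `&` cdom a)) x.
  by apply: open_nbhs_nbhs; split=> //; exists p.
have U2 : \forall x \near cmap a p, (cmap a @` (cdom c `&` cdom a)) x.
  by apply: open_nbhs_nbhs; split=> //; exists p.
apply: filterS2 U1 U2 => x [q [bq aq] <-] [q' [cq' aq'] qq'].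
have qE := mfd_inj hM aq' aq qq'; rewrite qE in cq'.
by rewrite !transitionE.
Qed.

End Manifold.

(** * Covector rays and the charts of the cosphere bundle *)

Lemma mulmx_tr_comp (R : comPzRingType) k l m p (v : 'M[R]_(p, m))
    (A : 'M[R]_(l, m)) (B : 'M[R]_(k, l)) (C : 'M[R]_(k, m)) :
  C = B *m A -> v *m C^T = v *m A^T *m B^T.
Proof. by move->; rewrite trmx_mul mulmxA. Qed.

Section Rays.
Variables (R : realType) (d : nat) (M : charted R d).
Hypothesis hM : oriented_manifold M.
Implicit Types (z : cosphere_pt M) (a b : chart M).

Lemma transition_jac_unitmx a b p :
  cdom a p -> cdom b p -> transition_jac a b p \in unitmx.
Proof.
by move=> ap bp; rewrite unitmxE unitfE gt_eqF // (mfd_oriented hM ap bp).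
Qed.

Lemma ray_cdom z a xi : ray z a xi -> cdom a (base z).
Proof. by have [c [xi0 [_ _ /(_ a xi) rE]]] := rayP z; move=> /rE[]. Qed.

(** Covectors transform by the transposed Jacobian matrix, and the cocycle
  identity makes this compatible with the reference chart of the ray. *)
Lemma ray_change z a b xi : ray z a xi -> cdom b (base z) ->
  ray z b (xi *m (transition_jac b a (base z))^T).
Proof.
have [c [xi0 [cz _ rE]]] := rayP z; move=> /rE[az [l l0 lE]] bz; apply/rE.
split; first by [].
exists l; first by [].
rewrite lE; exact: mulmx_tr_comp (transition_jac_cocycle hM cz bz az).
Qed.

Lemma ray_scale z a xi l : 0 < l -> ray z a xi -> ray z a (l *: xi).
Proof.
have [c [xi0 [cz _ rE]]] := rayP z; move=> l0 /rE[az [k k0 kE]]; apply/rE.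
split; first by [].
exists (l * k); first by rewrite mulr_gt0.
by rewrite -scalerA kE scalemxAl.
Qed.

Lemma ray_unique z a xi xi' : ray z a xi -> ray z a xi' ->
  exists2 l, 0 < l & xi' = l *: xi.
Proof.
have [c [xi0 [cz _ rE]]] := rayP z.
move=> /rE[az [k k0 kE]] /rE[_ [k' k'0 k'E]]; exists (k' / k).
  by rewrite divr_gt0.
have Ju : (transition_jac c a (base z))^T \in unitmx.
  by rewrite unitmx_tr transition_jac_unitmx.
have -> : xi = k *: (xi0 *m invmx (transition_jac c a (base z))^T).
  by rewrite scalemxAl kE mulmxK.
by rewrite scalerA divfK ?gt_eqF // scalemxAl k'E mulmxK.
Qed.

End Rays.

Section CosphereCharts.
Variables (R : realType) (n : nat) (M : charted R (n + 1)).
Hypothesis hM : oriented_manifold M.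

(** The factor by which a covector is divided when it is normalized to (eta, 1)
  A; it is positive exactly on the domain of the chart. *)
Definition last_coord (A : posdet R (n + 1)) (xi : 'rV[R]_(n + 1)) : R :=
  rsubmx (xi *m invmx (val A)) 0 0.

Lemma posdet_unitmx (A : posdet R (n + 1)) : val A \in unitmx.
Proof. by rewrite unitmxE unitfE gt_eqF // (valP A). Qed.

Lemma row_mx1_scale (xi : 'rV[R]_(n + 1)) : rsubmx xi 0 0 != 0 ->
  rsubmx xi 0 0 *: row_mx ((rsubmx xi 0 0)^-1 *: lsubmx xi) 1 = xi.
Proof.
move=> x0; rewrite scale_row_mx scalerA divff // scale1r -[RHS]hsubmxK.
congr row_mx; apply/matrixP => i j; rewrite !ord1 -[1]/(1%:M) !mxE eqxx.
by rewrite mulr1.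
Qed.

Lemma cosphere_coord (C : chart (cosphere M)) (z : cosphere M) xi :
  ray z C.1 xi -> 0 < last_coord C.2 xi ->
  cdom C z /\ cmap C z = row_mx (cmap C.1 (base z))
    ((last_coord C.2 xi)^-1 *: lsubmx (xi *m invmx (val C.2))).
Proof.
case: C => c A /= rz; set k := xi *m _; set l := last_coord A xi => l0.
pose eta := l^-1 *: lsubmx k.
have kE : l *: row_mx eta 1 = k by rewrite row_mx1_scale // gt_eqF.
have reta : ray z c (row_mx eta 1 *m val A).
  have -> : row_mx eta 1 *m val A = l^-1 *: xi.
    rewrite -[xi in RHS](mulmxKV (posdet_unitmx A)) -/k -kE -scalemxAl scalerA.
    by rewrite mulVf ?scale1r // gt_eqF.
  by apply: ray_scale => //; rewrite invr_gt0.
split; first by exists eta.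
rewrite /cmap /= /cosphere_map /=; congr row_mx.
have /getI /= rget : [set eta | ray z c (row_mx eta 1 *m val A)] eta by [].
set eta' := get _ in rget *.
have [m mpos] := ray_unique hM reta rget.
rewrite scalemxAl => /(can_inj (mulmxK (posdet_unitmx A))).
rewrite scale_row_mx => /eq_row_mx[-> m1].
suff -> : m = 1 by rewrite scale1r.
by move/matrixP/(_ 0 0): m1; rewrite !mxE eqxx mulr1.
Qed.

Lemma cosphere_cdom (C : chart (cosphere M)) (z : cosphere M) xi :
  cdom C z -> ray z C.1 xi -> 0 < last_coord C.2 xi.
Proof.
case: C => c A [eta /= reta] rxi; have [l l0 ->] := ray_unique hM reta rxi.
rewrite /last_coord -scalemxAl (mulmxK (posdet_unitmx A)) scale_row_mx row_mxKr.
by rewrite !mxE eqxx mulr1.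
Qed.

Lemma cosphere_base_coord (C : chart (cosphere M)) (z : cosphere M) :
  lsubmx (cmap C z) = cmap C.1 (base z).
Proof. by rewrite /cmap /= /cosphere_map row_mxKl. Qed.

Lemma cosphere_coord_ray (C : chart (cosphere M)) (z : cosphere M) :
  cdom C z -> ray z C.1 (row_mx (rsubmx (cmap C z)) 1 *m val C.2).
Proof.
case=> eta reta; rewrite /cmap /= /cosphere_map row_mxKr.
by have /getI : [set eta | ray z C.1 (row_mx eta 1 *m val C.2)] eta by [].
Qed.

(** Smoothness is given in some chart of the cosphere bundle; the base point
  and a representing covector are transported to the chart c by the transition
  map and its Jacobian matrix. The covector is kept unnormalized, so that no
  chart of the fibre has to be chosen yet. *)
Lemma smooth_map_cosphere (V : normedModType R) (U : set V)
    (g : V -> cosphere M) x c :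
  smooth_map U g -> U x -> cdom c (base (g x)) ->
  C1_near (fun y => cmap c (base (g y))) x /\
  exists k : V -> 'rV[R]_(n + 1), \forall y \near x,
    [/\ cdom c (base (g y)), differentiable k y & ray (g y) c (k y)].
Proof.
move=> gs Ux cgx; have [C [W [Wo Wx WU Wdom Wsm]]] := gs x Ux.
have {WU} WC y : W y -> cdom C.1 (base (g y)).
  by move=> /Wdom/cosphere_coord_ray/ray_cdom.
pose b y : 'rV[R]_(n + 1) := cmap C.1 (base (g y)).
have bE : b = lsubmx \o (fun y => cmap C (g y)).
  by apply/funext => y; rewrite /= cosphere_base_coord.
have gC : C1_near (fun y => cmap C (g y)) x by exact: Cinf_C1_near Wsm.
have bC : C1_near b x.
  by rewrite bE; apply: C1_near_linear => //; exact: continuous_lsubmx.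
have nearW : \forall y \near x, W y by exact: open_nbhs_nbhs.
have nearc : \forall y \near x, cdom c (base (g y)).
  have oU := @mfd_open _ _ _ hM c C.1.
  have bc : b y @[y --> x] --> b x := C1_near_continuous bC.
  have : \forall y \near x, (cmap C.1 @` (cdom c `&` cdom C.1)) (b y).
    apply: (bc (cmap C.1 @` (cdom c `&` cdom C.1))); apply: open_nbhs_nbhs.
    by split=> //; exists (base (g x)) => //; split=> //; exact: WC.
  apply: filterS2 nearW => y Wy [p [cp Cp] pE].
  by rewrite -(mfd_inj hM Cp (WC _ Wy) pE).
have tE : \forall y \near x, (transition C.1 c \o b) y = cmap c (base (g y)).
  apply: filterS2 nearW nearc => y Wy cy.
  by rewrite /= (transitionE hM) //; exact: WC.
have cC : C1_near (fun y => cmap c (base (g y))) x.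
  have cx := nbhs_singleton nearc; have Cx := WC _ (nbhs_singleton nearW).
  apply: C1_near_eq tE _; apply: C1_near_comp => //.
  exact: transition_C1_near.
split; first by [].
pose xi y : 'rV[R]_(n + 1) := row_mx (rsubmx (cmap C (g y))) 1 *m val C.2.
pose J i y := 'D_(delta_mx 0 i) (transition c C.1) (cmap c (base (g y))).
exists (fun y => \row_i \sum_j xi y 0 j * J i y 0 j).
apply: filterS3 nearW nearc cC => y Wy cy [cd _].
have xiray : ray (g y) C.1 (xi y) by apply: cosphere_coord_ray; exact: Wdom.
have td := transition_differentiable hM cy (WC _ Wy).
split; first by [].
- have gd : differentiable (fun y => cmap C (g y)) y.
    exact: Cinf_differentiable Wsm Wy.
  have xid : differentiable xi y.
    apply: differentiable_mulmxr; apply: differentiable_row_mx.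
      by apply: differentiable_comp gd _; exact: differentiable_rsubmx.
    exact: differentiable_cst.
  have Jd i : differentiable (J i) y.
    apply: (@differentiable_comp _ _ _ _ (fun y => cmap c (base (g y)))
      ('D_(delta_mx 0 i) (transition c C.1))) => //.
    apply: Cinf_differentiable (Cinf_derive _ (mfd_smooth hM c C.1)) _.
    by exists (base (g y)) => //; split=> //; exact: WC.
  apply: differentiable_rV => i; under eq_fun do rewrite mxE.
  apply: differentiable_sumr => j.
  by apply: differentiableM; apply: differentiable_entry.
- have -> : \row_i \sum_j xi y 0 j * J i y 0 j
      = xi y *m (transition_jac c C.1 (base (g y)))^T.
    apply/rowP => i; rewrite mxE [RHS]mxE; apply: eq_bigr => j _.
    congr (_ * _); rewrite [RHS]mxE; exact: esym (jacobian_entry _ _ td).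
  exact: (ray_change hM xiray cy).
Qed.

(** Normalizing the covector of [smooth_map_cosphere] is a division by a
  nonvanishing differentiable function. *)
Lemma smooth_map_cosphere_chart (V : normedModType R) (U : set V)
    (g : V -> cosphere M) x (C : chart (cosphere M)) :
  smooth_map U g -> U x -> cdom C (g x) ->
  \forall y \near x, cdom C (g y) /\ differentiable (fun y => cmap C (g y)) y.
Proof.
move=> gs Ux Cgx; have rx := cosphere_coord_ray Cgx.
have [bC [k kP]] := smooth_map_cosphere gs Ux (ray_cdom rx).
have [_ kdx rkx] := nbhs_singleton kP.
pose A := val C.2; pose K y : 'rV[R]_(n + 1) := k y *m invmx A.
have ld y : differentiable k y -> differentiable (fun y => last_coord C.2 (k y)) y.
  move=> kd; apply: differentiable_entry.
  apply: (@differentiable_comp _ _ _ _ K rsubmx); last exact: differentiable_rsubmx.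
  exact: differentiable_mulmxr.
have lpos : \forall y \near x, 0 < last_coord C.2 (k y).
  have lc : last_coord C.2 (k y) @[y --> x] --> last_coord C.2 (k x).
    exact: (differentiable_continuous (ld _ kdx)).
  by apply: (cvgr_gt _ lc); exact: cosphere_cdom Cgx rkx.
have FE : \forall y \near x, cdom C (g y) /\
    row_mx (cmap C.1 (base (g y))) ((last_coord C.2 (k y))^-1 *: lsubmx (K y))
    = cmap C (g y).
  apply: filterS2 kP lpos => y [_ _ ry] ly.
  by have [Cy ->] := cosphere_coord ry ly.
apply: filterS2 (near_near FE)
  (@filterI _ (nbhs x) _ _ _ kP (@filterI _ (nbhs x) _ _ _ bC lpos)).
move=> y FEy [[_ kd _] [[bd _] ly]]; split; first by have [] := nbhs_singleton FEy.
apply: differentiable_near_eq (filterS (fun z => @proj2 _ _) FEy) _.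
apply: differentiable_row_mx => //; apply: differentiable_rV => j.
under eq_fun do rewrite mxE; apply: differentiableM.
  by apply: differentiableV; [exact: ld | rewrite gt_eqF].
apply: differentiable_entry.
apply: (@differentiable_comp _ _ _ _ K lsubmx); last exact: differentiable_lsubmx.
exact: differentiable_mulmxr.
Qed.
End CosphereCharts.

(** * Maps on the sphere as 0-homogeneous maps *)

Section Sphere.
Variables (R : realType) (n : nat).
Implicit Types (s : sphere R n) (x v : 'rV[R]_(n + 1)).

Lemma sqnorm_ge0 x : 0 <= sqnorm x.
Proof. by apply: sumr_ge0 => i _; exact: sqr_ge0. Qed.

Lemma sqnormZ (l : R) x : sqnorm (l *: x) = l ^+ 2 * sqnorm x.
Proof. by rewrite mulr_sumr; apply: eq_bigr => i _; rewrite mxE exprMn. Qed.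

Lemma sqnorm_eq0 x : sqnorm x = 0 -> x = 0.
Proof.
move=> /eqP; rewrite psumr_eq0 => [/allP x0|i _]; last exact: sqr_ge0.
apply/rowP => i; rewrite mxE; apply/eqP; rewrite -sqrf_eq0.
exact: (implyP (x0 i (mem_index_enum i))).
Qed.

Lemma sqnorm_val s : sqnorm (val s) = 1.
Proof. exact: eqP (valP s). Qed.

Lemma val_neq0 s : val s != 0.
Proof.
apply/eqP => s0; have := sqnorm_val s; rewrite s0 /sqnorm big1 => [/eqP|i _].
  by rewrite eq_sym oner_eq0.
by rewrite mxE expr0n.
Qed.

Lemma sph_proj_val s : sph_proj (val s) = s.
Proof.
by rewrite /sph_proj sqnorm_val sqrtr1 invr1 scale1r; exact: valKd.
Qed.

Lemma sph_projZ (l : R) x : 0 < l -> sph_proj (l *: x) = sph_proj x.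
Proof.
move=> l0; rewrite /sph_proj sqnormZ sqrtrM ?sqr_ge0 // sqrtr_sqr gtr0_norm //.
by rewrite scalerA invfM mulrAC mulVf ?mul1r // gt_eqF.
Qed.

Lemma val_sph_proj x : x != 0 ->
  val (sph_proj x) = (Num.sqrt (sqnorm x))^-1 *: x.
Proof.
move=> x0; rewrite /sph_proj insubdK // unfold_in sqnormZ.
have q0 : 0 < sqnorm x.
  rewrite lt_neqAle sqnorm_ge0 andbT eq_sym; apply/eqP => /sqnorm_eq0 xE.
  by rewrite xE eqxx in x0.
by rewrite exprVn sqr_sqrtr ?sqnorm_ge0 // mulVf // gt_eqF.
Qed.

Lemma sqnorm_continuous : continuous (@sqnorm R (n + 1)).
Proof.
move=> x; apply: differentiable_continuous; apply: differentiable_sumr => i.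
under eq_fun do rewrite expr2; apply: differentiableM; exact: differentiable_coord.
Qed.

Lemma val_sph_proj_cvg s : val (sph_proj x) @[x --> val s] --> val s.
Proof.
have c : Num.sqrt (sqnorm x) @[x --> val s] --> (1 : R).
  have c0 : Num.sqrt (sqnorm x) @[x --> val s] --> Num.sqrt (sqnorm (val s)).
    exact: (cvg_comp _ _ (@sqnorm_continuous _) (@sqrt_continuous _ _)).
  by move: c0; rewrite sqnorm_val sqrtr1.
have nz : \forall x \near val s, (Num.sqrt (sqnorm x))^-1 *: x = val (sph_proj x).
  have p : \forall x \near val s, 0 < Num.sqrt (sqnorm x) by exact: (cvgr_gt _ c).
  apply: filterS p => x px; rewrite val_sph_proj //; apply/eqP => x0.
  move: px; rewrite x0 /sqnorm big1 ?sqrtr0 ?ltxx // => i _.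
  by rewrite mxE expr0n.
apply: cvg_trans (near_eq_cvg nz) _.
have cI : (Num.sqrt (sqnorm x))^-1 @[x --> val s] --> (1 : R).
  by rewrite -[X in _ --> X]invr1; apply: cvgV c; rewrite oner_eq0.
have := cvgZ cI (@cvg_id _ (nbhs (val s))); rewrite scale1r; apply.
Qed.

(** The extension is constant along the ray through s. *)
Lemma derive_radial (W : normedModType R) (h : sphere R n -> W) s :
  'D_(val s) (fun x => h (sph_proj x)) (val s) = 0.
Proof.
rewrite /derive; apply: cvg_lim => //; apply: cvg_near_cst.
have : \forall l \near (0 : R)^', -1 < l.
  by apply: nbhs_dnbhs; apply: lt_nbhsr; rewrite oppr_lt0.
apply: filterS => l l1; rewrite /= -[X in _ *: _ + X]scale1r -scalerDl.
by rewrite sph_projZ ?subrr ?scaler0 // -ltrBlDr sub0r.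
Qed.

(** Since radial derivatives vanish, conditions on tangent vectors of the
  sphere extend to all directions of the ambient space. *)
Lemma derive_tangent_part (W : normedModType R) (h : sphere R n -> W) s v :
  differentiable (fun x => h (sph_proj x)) (val s) ->
  exists v', tangent s v' /\ 'D_v' (fun x => h (sph_proj x)) (val s)
    = 'D_v (fun x => h (sph_proj x)) (val s).
Proof.
move=> hd; exists (v - (v *m (val s)^T) 0 0 *: val s); split.
  rewrite /tangent mulmxBl -scalemxAl [X in _ - _ *: X]mx11_scalar.
  have -> : (val s *m (val s)^T) 0 0 = 1.
    rewrite -[RHS](sqnorm_val s) mxE; apply: eq_bigr => i _.
    by rewrite mxE expr2.
  by rewrite -[1%:M]scalemx1 scale1r scalemx1 -mx11_scalar subrr.
rewrite !deriveE // linearB linearZ /= -[in X in _ - _ *: X]deriveE //.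
by rewrite derive_radial scaler0 subr0.
Qed.

Lemma frame_row_free s (r : 'M[R]_(n, n + 1)) : pos_frame s r -> row_free r.
Proof.
move=> [_ dr].
have : row_free (col_mx r (val s)).
  by rewrite row_free_unit unitmxE unitfE gt_eqF.
move/row_freeP => [B]; rewrite mul_col_mx -[B]hsubmxK.
rewrite -[RHS]/(1%:M : 'M[R]_(n + 1)) scalar_mx_block => /eq_col_mx[rB _].
apply/row_freeP; exists (lsubmx B).
by move: rB; rewrite mul_mx_row => /eq_row_mx[].
Qed.

End Sphere.

(** * A Legendrian branch whose front is a graph *)

Section Branch.
Variables (R : realType) (n : nat) (M : charted R (n + 1)).
Hypothesis hM : oriented_manifold M.
Variables (phi : sphere R n -> cosphere M) (s : sphere R n) (c : chart M).
Variables (xi : 'rV[R]_(n + 1)) (U : set 'rV[R]_n) (f : 'rV[R]_n -> R).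
Hypothesis leg : legendrian_immersion phi.
Hypothesis hc : cdom c (front phi s).
Hypothesis hc0 : cmap c (front phi s) = 0.
Hypothesis xi_ray : ray (phi s) c xi.
Hypothesis xi_neg : vcoord xi < 0.
Hypotheses (Uo : open U) (U0 : U 0) (fC : Cinf U f).
Hypothesis graph : \forall x \near val s,
    vcoord (cmap c (front phi (sph_proj x)))
      = f (hcoord (cmap c (front phi (sph_proj x)))).
Hypothesis reg : regular_at (front phi) s.

Let b x : 'rV[R]_(n + 1) := cmap c (front phi (sph_proj x)).
Let h x : 'rV[R]_n := hcoord (b x).

Let lift_smooth : smooth_map [set x : 'rV[R]_(n + 1) | x != 0]
  (fun x => phi (sph_proj x)) := proj1 (proj1 leg).

Let b_val : b (val s) = 0. Proof. by rewrite /b sph_proj_val. Qed.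
Let h_val : h (val s) = 0. Proof. by rewrite /h b_val /hcoord linear0. Qed.

Let bC : C1_near b (val s).
Proof.
have hcv : cdom c (base (phi (sph_proj (val s)))) by rewrite sph_proj_val.
by have [] := smooth_map_cosphere hM lift_smooth (val_neq0 s) hcv.
Qed.

Let hC : C1_near h (val s).
Proof. exact: C1_near_linear (@continuous_lsubmx _ _ _ _) bC. Qed.

Let h_near_U : \forall x \near val s, U (h x).
Proof.
have hcv : h x @[x --> val s] --> h (val s) := C1_near_continuous hC.
by apply: (hcv U); apply: open_nbhs_nbhs; rewrite h_val.
Qed.

(** Along a graph the vertical velocity is the gradient applied to the
  horizontal one. *)
Lemma derive_branch : \forall y \near val s, forall v,
  'D_v b y = 'D_v h y *m row_mx 1%:M (gradient f (h y))^T.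
Proof.
apply: filterS3 (near_near graph) bC (@filterI _ (nbhs (val s)) _ _ _ hC h_near_U).
move=> y gy [bd _] [[hd _] hU] v.
have bE : b = fun x => row_mx (h x) (rsubmx (b x)).
  by apply/funext => x; rewrite hsubmxK.
have rd : differentiable (fun x => rsubmx (b x)) y.
  exact: (@differentiable_comp _ _ _ _ b rsubmx _ bd (differentiable_rsubmx _)).
rewrite {1}bE derive_row_mx // mul_mx_row mulmx1; congr row_mx.
apply/matrixP => i j; rewrite !ord1 -(derive_entry _ _ _ rd).
rewrite -derive_comp_gradient //; last exact: Cinf_differentiable fC hU.
exact: near_eq_derive.
Qed.

(** The differential of the front in horizontal coordinates; the sign of its
  determinant is the orientation of the branch. *)
Definition hframe (r : 'M[R]_(n, n + 1)) y : 'M[R]_n :=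
  \matrix_(i < n) 'D_(row i r) h y.

Lemma front_frame r :
  sph_diff_frame c (front phi) s r
    = hframe r (val s) *m row_mx 1%:M (gradient f 0)^T.
Proof.
apply/row_matrixP => i; rewrite rowK row_mul rowK /sph_diff.
by rewrite -[RHS](_ : 'D_(row i r) b (val s) = _) //
  (nbhs_singleton derive_branch) h_val.
Qed.

(** On a graph a velocity with zero horizontal part is zero, and the front is
  immersed at s. *)
Lemma hframe_det_neq0 r : pos_frame s r -> \det (hframe r (val s)) != 0.
Proof.
move=> pr; rewrite -unitfE -[_ \is a _]unitmxE -row_free_unit.
apply/inj_row_free => u uX.
have rs : tangent s (u *m r).
  by rewrite /tangent -mulmxA (proj1 pr) mulmx0.
apply: (row_free_inj (frame_row_free pr)); rewrite mul0mx.
apply: (@reg c _ hc rs).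
rewrite /sph_diff -/b (nbhs_singleton derive_branch).
have hd := C1_near_differentiable hC.
suff -> : 'D_(u *m r) h (val s) = 0 by rewrite mul0mx.
rewrite -uX (deriveE _ hd) mulmx_sum_row linear_sum [RHS]mulmx_sum_row.
by apply: eq_bigr => i _; rewrite linearZ /= rowK (deriveE _ hd).
Qed.

Definition graph_chart_mx : 'M[R]_(n + 1) :=
  block_mx (reflection_mx R n) 0 0 (-1)%:M.

Hypothesis n_gt0 : (0 < n)%N.

Lemma graph_chart_mx_det : 0 < \det graph_chart_mx.
Proof. by rewrite det_ublock det_reflection_mx // det_scalar expr1 mulrNN mulr1. Qed.

(** The chart in which the lift of a graph has fibre coordinate its gradient,
  up to the reflection. *)
Definition graph_chart : chart (cosphere M) :=
  (c, exist _ graph_chart_mx graph_chart_mx_det).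

Lemma graph_chart_mx_inv (k : 'rV[R]_(n + 1)) :
  k *m invmx graph_chart_mx = row_mx (lsubmx k *m reflection_mx R n) (- rsubmx k).
Proof.
have Gu := posdet_unitmx graph_chart.2.
apply: (can_inj (mulmxK Gu)) => /=; rewrite mulmxKV //.
rewrite mul_row_block !mulmx0 addr0 add0r -mulmxA reflection_mxK mulmx1.
by rewrite mul_mx_scalar scaleN1r opprK hsubmxK.
Qed.

Lemma graph_chart_last_coord (k : 'rV[R]_(n + 1)) :
  last_coord graph_chart.2 k = - vcoord k.
Proof. by rewrite /last_coord /= graph_chart_mx_inv row_mxKr mxE. Qed.

Lemma graph_chart_coord (z : cosphere M) (p : 'rV[R]_n) :
  ray z c (row_mx p (-1)) -> cdom graph_chart z /\
  cmap graph_chart z = row_mx (cmap c (base z)) (p *m reflection_mx R n).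
Proof.
move=> rz.
have lE : last_coord graph_chart.2 (row_mx p (-1)) = 1.
  by rewrite graph_chart_last_coord /vcoord row_mxKr !mxE opprK.
have [] := cosphere_coord hM (C := graph_chart) rz; first by rewrite lE ltr01.
move=> zC zE; split=> //; rewrite zE lE invr1 scale1r /= graph_chart_mx_inv.
by rewrite !row_mxKl.
Qed.

(** The Legendrian condition speaks of tangent vectors at unit vectors y; it
  extends to all directions v by [derive_tangent_part]. *)
Lemma legendrian_conormal : \forall y \near val s, forall s' k v, y = val s' ->
  ray (phi s') c k -> k *m ('D_v b y)^T = 0.
Proof.
have Cs : cdom graph_chart (phi (sph_proj (val s))).
  rewrite sph_proj_val; have [] := cosphere_coord hM (C := graph_chart) xi_ray => //.
  by rewrite graph_chart_last_coord oppr_gt0.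
have := smooth_map_cosphere_chart hM lift_smooth (val_neq0 s) Cs.
apply: filterS2 bC => y [bd _] [Cy Fd] s' k v yE rk; rewrite {}yE in bd Cy Fd *.
have [v' [v'tan <-]] :=
  @derive_tangent_part _ _ _ (fun u => cmap c (front phi u)) s' v bd.
rewrite sph_proj_val in Cy.
have := (proj2 leg) s' graph_chart v' Cy v'tan k rk.
rewrite /sph_diff -(derive_linear v' (@continuous_lsubmx _ _ _ _) Fd).
have -> // : lsubmx \o (fun x => cmap graph_chart (phi (sph_proj x))) = b.
by apply/funext => x; rewrite /= cosphere_base_coord.
Qed.

(** The covector k annihilates the velocities of the front, which fill the
  tangent space of the graph as long as the determinant of the horizontal
  velocities is nonzero; so k is a multiple of (grad f, -1). The multiple stays
  positive near s because the last coordinate of k stays negative. *)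
Lemma lift_ray_unit r : pos_frame s r -> \forall y \near val s,
  forall s', y = val s' -> ray (phi s') c (row_mx (gradient f (h y)) (-1)).
Proof.
move=> pr.
have hcv : cdom c (base (phi (sph_proj (val s)))) by rewrite sph_proj_val.
have [_ [k kP]] := smooth_map_cosphere hM lift_smooth (val_neq0 s) hcv.
have [_ kds rks] := nbhs_singleton kP; rewrite sph_proj_val in rks.
have kneg : \forall y \near val s, vcoord (k y) < 0.
  have vd : differentiable (fun y => vcoord (k y)) (val s).
    apply: differentiable_entry.
    exact: (@differentiable_comp _ _ _ _ k rsubmx _ kds (differentiable_rsubmx _)).
  have vc : vcoord (k y) @[y --> val s] --> vcoord (k (val s)).
    exact: (differentiable_continuous vd).
  apply: (cvgr_lt _ vc); have [l l0 ->] := ray_unique hM xi_ray rks.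
  by rewrite /vcoord linearZ mxE pmulr_rlt0.
have detN0 : \forall y \near val s, \det (hframe r y) != 0.
  have dc : \det (hframe r y) @[y --> val s] --> \det (hframe r (val s)).
    apply: (@cvg_det _ _ (nbhs (val s)) _ n (hframe r)) => i j.
    under eq_fun do rewrite mxE; rewrite mxE.
    have hc' : 'D_(row i r) h y @[y --> val s] --> 'D_(row i r) h (val s).
      exact: (proj2 (nbhs_singleton hC)).
    exact: (cvg_comp _ _ hc' (@coord_continuous _ _ _ _ _ _)).
  by apply: cvgr_neq0 dc _; exact: hframe_det_neq0.
near=> y => s' yE.
have conormal : forall s' k v, y = val s' -> ray (phi s') c k ->
    k *m ('D_v b y)^T = 0 by near: y; exact: legendrian_conormal.
have Db : forall v, 'D_v b y = 'D_v h y *m row_mx 1%:M (gradient f (h y))^T.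
  by near: y; exact: derive_branch.
have [_ _] : [/\ cdom c (base (phi (sph_proj y))), differentiable k y
  & ray (phi (sph_proj y)) c (k y)] by near: y.
rewrite {1}yE sph_proj_val => ry.
have ky : vcoord (k y) < 0 by near: y.
have dy : \det (hframe r y) != 0 by near: y.
set g := gradient f (h y); pose z := lsubmx (k y) + rsubmx (k y) *m g.
have z0 : z = 0.
  have zX : z *m (hframe r y)^T = 0.
    apply/rowP => i; rewrite mxE [RHS]mxE.
    move: (conormal s' (k y) (row i r) yE ry); rewrite Db.
    rewrite trmx_mul tr_row_mx trmx1 trmxK mulmxA.
    rewrite -{1}[k y]hsubmxK mul_row_col mulmx1 -/z => /matrixP/(_ 0 0).
    rewrite mxE [RHS]mxE; apply: etrans; apply: eq_bigr => j _; congr (_ * _).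
    by rewrite [LHS]mxE [LHS]mxE [RHS]mxE.
  have Xu : (hframe r y)^T \in unitmx by rewrite unitmx_tr unitmxE unitfE.
  by rewrite -[z](mulmxK Xu) zX mul0mx.
have kE : k y = - vcoord (k y) *: row_mx g (-1).
  rewrite -[LHS]hsubmxK scale_row_mx; congr row_mx.
    rewrite -[LHS](addrK (rsubmx (k y) *m g)) -/z z0 sub0r.
    by rewrite [rsubmx _]mx11_scalar mul_scalar_mx scaleNr.
  by rewrite [LHS]mx11_scalar scalerN scaleNr opprK scale_scalar_mx mulr1.
have lpos : 0 < (- vcoord (k y))^-1 by rewrite invr_gt0 oppr_gt0.
have := ray_scale lpos ry; rewrite {2}kE scalerA mulVf ?scale1r //.
by rewrite oppr_eq0 lt_eqF.
Unshelve. all: by end_near. Qed.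

(** The identity at the unit vectors passes to nearby vectors by radial
  projection. *)
Lemma lift_ray r : pos_frame s r -> \forall x \near val s,
  ray (phi (sph_proj x)) c (row_mx (gradient f (h x)) (-1)).
Proof.
move=> pr; have P : \forall x \near val s, forall s', val (sph_proj x) = val s' ->
    ray (phi s') c (row_mx (gradient f (h (val (sph_proj x)))) (-1)).
  exact: (val_sph_proj_cvg (lift_ray_unit pr)).
apply: filterS P => x /(_ _ erefl).
by rewrite /h /b sph_proj_val.
Qed.

Lemma lift_coord r : pos_frame s r -> \forall x \near val s,
  cmap graph_chart (phi (sph_proj x))
    = row_mx (b x) (gradient f (h x) *m reflection_mx R n).
Proof.
move=> pr; apply: filterS (lift_ray pr) => x rx.
by have [_ ->] := graph_chart_coord rx.
Qed.

(** Derivative of the 1-jet (x', f(x'), grad f(x') D): the chain rule makes the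
  Hessian appear in the last block. *)
Lemma lift_frame r : pos_frame s r ->
  sph_diff_frame graph_chart phi s r = hframe r (val s) *m
    row_mx (row_mx 1%:M (gradient f 0)^T) (hessian f 0 *m reflection_mx R n).
Proof.
move=> pr; have [bd _] := nbhs_singleton bC; have [hd _] := nbhs_singleton hC.
have gd : differentiable (gradient f) (h (val s)).
  by rewrite h_val; exact: differentiable_gradient fC U0.
have ghd := differentiable_comp hd gd.
apply/row_matrixP => i; rewrite rowK row_mul rowK /sph_diff.
rewrite -(near_eq_derive _ (filterS (fun x => @esym _ _ _) (lift_coord pr))).
rewrite derive_row_mx //; last exact: (differentiable_mulmxr _ ghd).
rewrite (derive_mulmxr _ _ ghd) (nbhs_singleton derive_branch) h_val.
rewrite [RHS]mul_mx_row mulmxA; congr (row_mx _ (_ *m _)).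
rewrite (deriveE _ ghd) (diff_comp hd gd) /= -(deriveE _ hd) -(deriveE _ gd).
by rewrite (deriveEjacobian _ gd) h_val (jacobian_gradient fC U0).
Qed.
End Branch.

(** * Motion of a branch in time *)

Section TimeSlice.
Variables (R : realType) (V W : normedModType R) (g : R * V -> W).

Lemma time_slice_quotient t x :
  (fun h : R => h^-1 *: (((fun u => g (u, x)) \o shift t) (h *: 1) - g (t, x)))
  = (fun h : R => h^-1 *: ((g \o shift (t, x)) (h *: (1, 0)) - g (t, x))).
Proof.
apply/funext => h /=; congr (_ *: (g _ - _)).
by congr pair; rewrite /= ?scaler0 ?add0r.
Qed.

Lemma derive_time_slice t x : 'D_1 (fun u => g (u, x)) t = 'D_(1, 0) g (t, x).
Proof. by rewrite /derive time_slice_quotient. Qed.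

Lemma derivable_time_slice t x :
  differentiable g (t, x) -> derivable (fun u => g (u, x)) t 1.
Proof.
by move=> /diff_derivable gd; rewrite /derivable time_slice_quotient; exact: gd.
Qed.

End TimeSlice.

(** By the mean value theorem in t at the fixed point x = u t, the quotient is
  the time derivative at some (v, u t) with v between t0 and t; this converges
  whatever the rate of convergence of u, since the derivative is continuous in
  both variables. *)
Lemma slope_along_curve (R : realType) (V : normedModType R) (g : R * V -> R)
    (t0 : R) (x0 : V) (u : R -> V) :
  C1_near g (t0, x0) -> (\forall x \near x0, g (t0, x) = 0) ->
  u t @[t --> t0^'+] --> x0 ->
  (t - t0)^-1 * g (t, u t) @[t --> t0^'+] --> 'D_(1, 0) g (t0, x0).
Proof.
move=> gC g0 ux; have [_ /(_ (1, 0)) Dc] := nbhs_singleton gC.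
apply/cvgrPdist_lt => e e0.
have near_e : \forall p \near (t0, x0), `|'D_(1, 0) g (t0, x0) - 'D_(1, 0) g p| < e.
  by move/cvgrPdist_lt : Dc => /(_ e e0).
have : \forall p \near (t0, x0), differentiable g p /\
    `|'D_(1, 0) g (t0, x0) - 'D_(1, 0) g p| < e.
  by apply: filterS2 gC near_e => p [].
move=> [[A B] /= [/nbhs_ballP[d /= d0 dA] xB] AB].
near=> t.
have t0t : t0 < t by near: t; exact: nbhs_right_gt.
have tA v : t0 <= v <= t -> A v.
  move=> /andP[t0v vt]; apply: dA; rewrite /ball /= ler0_norm ?subr_le0 //.
  rewrite opprB ltrBlDl (le_lt_trans vt) //; near: t.
  by apply: nbhs_right_lt; rewrite ltrDl.
have utB : B (u t) by near: t; exact: ux.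
have gut : g (t0, u t) = 0 by near: t; exact: (ux _ g0).
pose G v := g (v, u t).
have Gd v : t0 <= v <= t -> derivable G v 1.
  by move=> /tA vA; apply: derivable_time_slice; have [] := AB (v, u t).
have [||v vI] := @MVT R G (fun v => 'D_1 G v) t0 t t0t.
- move=> v; rewrite in_itv /= => /andP[vl vr]; apply: derivableP.
  by apply: Gd; rewrite !ltW.
- apply: derivable_within_continuous => v; rewrite in_itv /=; exact: Gd.
rewrite {1 2}/G gut subr0 derive_time_slice => ->.
rewrite mulrC mulfK ?subr_eq0 ?gt_eqF //.
move: vI; rewrite in_itv /= => /andP[vl vr].
by have [] := AB (v, u t) (conj (tA _ _) utB) => //=; rewrite !ltW.
Unshelve. all: by end_near. Qed.

Lemma smooth_path_domain (R : realType) n (a b e t0 : R) (s : sphere R n) :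
  0 < e -> a <= t0 <= b ->
  [set tx : R * 'rV[R]_(n + 1) | a - e < tx.1 < b + e /\ tx.2 != 0] (t0, val s).
Proof.
move=> e0 /andP[at0 t0b]; split; last exact: val_neq0.
by rewrite /= ltrBlDr (le_lt_trans at0) ?ltrDl //= (le_lt_trans t0b) ?ltrDl.
Qed.

Lemma smooth_path_chart_differentiable (R : realType) n (M : charted R (n + 1))
    (hM : oriented_manifold M) (a b t0 : R)
    (gamma : R -> sphere R n -> cosphere M) (s : sphere R n)
    (C : chart (cosphere M)) :
  smooth_path a b gamma -> a <= t0 <= b -> cdom C (gamma t0 s) ->
  differentiable (fun t => cmap C (gamma t s)) t0.
Proof.
move=> [e e0 gs] t0I Cs; have inU := smooth_path_domain s e0 t0I.
have Cv : cdom C (gamma (t0, val s).1 (sph_proj (t0, val s).2)).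
  by rewrite /= sph_proj_val.
have [_ Pd] := nbhs_singleton (smooth_map_cosphere_chart hM gs inU Cv).
have pd : differentiable (fun t : R => (t, val s)) t0.
  by apply: differentiable_pair; [exact: ex_diff | exact: differentiable_cst].
have := differentiable_comp pd Pd; rewrite /comp /=.
by under eq_fun do rewrite sph_proj_val.
Qed.

(** The function x_m - f(x') of the moving branch vanishes at time t0 along the
  branch and equals the height at the points over the origin. *)
Lemma branch_height (R : realType) n (M : charted R (n + 1))
    (hM : oriented_manifold M) (a b t0 : R)
    (gamma : R -> sphere R n -> cosphere M) (s : sphere R n) (c : chart M)
    (U : set 'rV[R]_n) (f : 'rV[R]_n -> R) (u : R -> sphere R n) :
  smooth_path a b gamma -> a <= t0 <= b -> cdom c (front (gamma t0) s) ->
  cmap c (front (gamma t0) s) = 0 -> open U -> U 0 -> Cinf U f ->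
  (\forall x \near val s,
    vcoord (cmap c (front (gamma t0) (sph_proj x)))
      = f (hcoord (cmap c (front (gamma t0) (sph_proj x))))) ->
  point_over_origin c gamma t0 s u ->
  let w := 'D_1 (fun t => cmap c (front (gamma t) s)) t0 in
  (t - t0)^-1 * vcoord (cmap c (front (gamma t) (u t))) @[t --> t0^'+] -->
    vcoord w - (hcoord w *m (gradient f 0)^T) 0 0.
Proof.
move=> [e e0 gs] t0I hc hc0 Uo U0 fC graph [us uo] w.
have f0 : f 0 = 0.
  have := nbhs_singleton graph; rewrite sph_proj_val hc0.
  by rewrite /hcoord linear0 /vcoord linear0 mxE => <-.
pose P (tx : R * 'rV[R]_(n + 1)) : 'rV[R]_(n + 1) :=
  cmap c (front (gamma tx.1) (sph_proj tx.2)).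
have inU := smooth_path_domain s e0 t0I.
have hcv : cdom c (base (gamma (t0, val s).1 (sph_proj (t0, val s).2))).
  by rewrite /= sph_proj_val.
have [PC _] := smooth_map_cosphere hM gs inU hcv.
rewrite -/P in PC.
have P0 : P (t0, val s) = 0 by rewrite /P /= sph_proj_val.
pose k (y : 'rV[R]_(n + 1)) := vcoord y - f (hcoord y).
have idd (y : 'rV[R]_(n + 1)) : differentiable id y by exact: ex_diff.
have vC : C1_near (@vcoord R n) 0.
  apply: (@C1_near_cst_derive _ _ _ _ (@vcoord R n)) => [y|v y].
    exact: differentiable_vcoord (idd y).
  by rewrite (derive_vcoord v (idd y)) derive_id.
have fhC : C1_near (f \o @hcoord R n) 0.
  apply: C1_near_comp.
    apply: (@C1_near_cst_derive _ _ _ _ (@hcoord R n)) => [y|v y].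
      exact: differentiable_lsubmx.
    by rewrite (derive_lsubmx v (idd y)) derive_id.
  by rewrite /hcoord linear0; exact: Cinf_C1_near fC.
have kC : C1_near k (P (t0, val s)) by rewrite P0; exact: (C1_near_sub vC fhC).
have gC := C1_near_comp PC kC.
have g0 : \forall x \near val s, (k \o P) (t0, x) = 0.
  by apply: filterS graph => x /= gx; rewrite /k /P /= gx subrr.
have := slope_along_curve gC g0 us.
have -> : 'D_(1, 0) (k \o P) (t0, val s)
    = vcoord w - (hcoord w *m (gradient f 0)^T) 0 0.
  have wE : w = 'D_(1, 0) P (t0, val s).
    apply: etrans _ (derive_time_slice P t0 (val s)); rewrite /w.
    suff -> : (fun t => cmap c (front (gamma t) s)) = (fun t => P (t, val s)) by [].
    by apply/funext => t; rewrite /P /= sph_proj_val.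
  have Pd := C1_near_differentiable PC.
  have hd : differentiable (fun p => hcoord (P p)) (t0, val s).
    exact: (@differentiable_comp _ _ _ _ P lsubmx _ Pd (differentiable_lsubmx _)).
  have hP0 : hcoord (P (t0, val s)) = 0 by rewrite P0 /hcoord linear0.
  have fd : differentiable f (hcoord (P (t0, val s))).
    by rewrite hP0; exact: Cinf_differentiable fC U0.
  have fhd := differentiable_comp hd fd.
  have vd := differentiable_vcoord Pd.
  apply: etrans (deriveB (diff_derivable vd) (diff_derivable fhd)) _.
  rewrite (derive_vcoord _ Pd) (derive_comp_gradient _ hd fd) hP0.
  by rewrite (derive_lsubmx _ Pd) wE.
apply: cvg_trans; apply: near_eq_cvg; apply: filterS uo => t [_ ut].
by rewrite /= /k /P /= sph_proj_val ut f0 subr0.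
Qed.

(** * The sign of the crossing *)

(** The last coordinate of the covector g(v, .) for v = - e_m is - g(e_m, e_m).
  *)
Lemma normal_ray_vcoord (R : realType) n (M : charted R (n + 1))
    (g : metric_data M) (c : chart M) (p : M) : riemannian g -> cdom c p ->
  vcoord (- vbasis_last R n *m g c (cmap c p)) < 0.
Proof.
move=> [_ gpos] cp; have e0 : vbasis_last R n != 0.
  apply/eqP => /rowP/(_ (rshift n 0)); rewrite row_mxEr !mxE eqxx => /eqP.
  by rewrite oner_eq0.
have := gpos c p _ cp e0; rewrite /qform mulNmx.
rewrite /vcoord linearN [X in X < 0]mxE oppr_lt0.
rewrite [in X in X -> _]/vbasis_last tr_row_mx -[X in X *m col_mx _ _]hsubmxK.
by rewrite mul_row_col trmx0 mulmx0 add0r trmx1 mulmx1.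
Qed.

Lemma joined_in_end (R : realType) n d (N : charted R d)
    (P : (sphere R n -> N) -> Prop) phi psi : joined_in P phi psi -> P psi.
Proof. by move=> [gamma [_ _ <-]]; apply; rewrite ler01 lexx. Qed.

(** The last coordinate -1 normalizes the covector, so the ray determines the
  gradient: tangent lifts have the same gradient. *)
Lemma ray_gradient_unique (R : realType) n (M : charted R (n + 1))
    (hM : oriented_manifold M) (z : cosphere M) (c : chart M) (p1 p2 : 'rV[R]_n) :
  ray z c (row_mx p1 (-1)) -> ray z c (row_mx p2 (-1)) -> p1 = p2.
Proof.
move=> r1 r2; have [l _] := ray_unique hM r1 r2.
rewrite scale_row_mx => /eq_row_mx[-> /matrixP/(_ 0 0)].
by rewrite !mxE mulrN mulr1 => /oppr_inj <-; rewrite scale1r.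
Qed.

Lemma sign_of_right_limit (R : realType) (F : R -> R) (t0 l : R) :
  F t @[t --> t0^'+] --> l -> l != 0 ->
  (\forall t \near t0^'+, 0 < F t) -> 0 < l.
Proof.
move=> Fl l0 Fpos; rewrite lt_neqAle eq_sym l0 /=.
by apply: (cvgr_to_ge Fl); apply: filterS Fpos => t /ltW.
Qed.

Theorem theorem2p7 (R : realType) (n : nat) (hn : (1 < n + 1)%N)
  (M : charted R (n + 1))
  (hM : is_cauchy_surface_of_globally_hyperbolic M)
  (g : metric_data M) (hg : riemannian g)
  (eps : M -> sphere R n -> cosphere M) (heps : fiber_family eps)
  (A : zmodType) (q : {additive int -> A}) (hq : is_quotient_by_Indet eps q)
  (alk : (sphere R n -> cosphere M) -> (sphere R n -> cosphere M) -> A)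
  (halk : is_alk eps q alk)
  (a b t0 : R) (gamma1 gamma2 : R -> sphere R n -> cosphere M) (e : int)
  (hgen : generic_path eps a b gamma1 gamma2 [:: (t0, e)])
  (hL : path_in (spaceL eps) a b gamma1 gamma2)
  (s1 s2 : sphere R n)
  (hdt : dangerous_tangency (gamma1 t0) (gamma2 t0) s1 s2)
  (c : chart M) (hc : cdom c (front (gamma1 t0) s1))
  (hc0 : cmap c (front (gamma1 t0) s1) = 0)
  (hnormal : has_normal g (gamma1 t0 s1) c (- vbasis_last R n))
  (f1 f2 : 'rV[R]_n -> R)
  (hf1 : branch_is_graph c (gamma1 t0) s1 f1)
  (hf2 : branch_is_graph c (gamma2 t0) s2 f2)
  (sigma : nat)
  (hsigma : sigma = num_neg_eigenvalues (hessian (fun x => f2 x - f1 x) 0))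
  (epsilon : int)
  (hepsilon : epsilon =
     if `[< same_orientation c (gamma1 t0) (gamma2 t0) s1 s2 >] then 1 else -1)
  (alpha : int)
  (halpha : height_sign_after c gamma1 gamma2 t0 s1 s2 alpha) :
  alk (gamma1 b) (gamma2 b) - alk (gamma1 a) (gamma2 a)
    = q (epsilon * alpha * (-1) ^+ sigma).
Proof.
have n_gt0 : (0 < n)%N by rewrite addn1 ltnS in hn.
have {}hM : oriented_manifold M by case: hM.
have [ltab _ _ _ /(_ (t0, e) (mem_head _ _))[/= /andP[at0 t0b]]] := hgen.
move=> [s1' [s2' [S0 e1 hcross]]].
have jump : alk (gamma1 b) (gamma2 b) - alk (gamma1 a) (gamma2 a) = q e.
  by rewrite (alk_jump halk hgen) big_seq1.
rewrite {}jump; congr (q _).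
have [[reg1 reg2] z12 uniq12 _ _] := hdt.
have [E1 E2] : s1' = s1 /\ s2' = s2 by case: S0 => z12' _ _ _ _; exact: uniq12.
subst s1' s2'.
have t0I : a <= t0 <= b by rewrite !ltW.
have [smooth1 smooth2 inL] := hL; have [[v1 L1] [v2 L2]] := inL _ t0I.
have leg1 := joined_in_end L1; have leg2 := joined_in_end L2.
have b12 : front (gamma2 t0) s2 = front (gamma1 t0) s1 by rewrite /front z12.
have hc' : cdom c (front (gamma2 t0) s2) by rewrite b12.
have hc0' : cmap c (front (gamma2 t0) s2) = 0 by rewrite b12.
have [[U1 [U1o U1x f1C]] graph1] := hf1.
have [[U2 [U2o U2x f2C]] graph2] := hf2.
have xim := normal_ray_vcoord hg hc.
pose xi := - vbasis_last R n *m g c (cmap c (front (gamma1 t0) s1)).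
have ray1 : ray (gamma1 t0 s1) c xi := hnormal.
have ray2 : ray (gamma2 t0 s2) c xi by rewrite -z12.
pose C := @graph_chart R n M c n_gt0.
have [r10 pr10] := exists_pos_frame n_gt0 s1.
have [r20 pr20] := exists_pos_frame n_gt0 s2.
have lray1 := nbhs_singleton (lift_ray hM leg1 hc hc0 ray1 xim U1o U1x f1C
  graph1 reg1 n_gt0 pr10).
have lray2 := nbhs_singleton (lift_ray hM leg2 hc' hc0' ray2 xim U2o U2x f2C
  graph2 reg2 n_gt0 pr20).
rewrite /= sph_proj_val hc0 /hcoord linear0 in lray1.
rewrite /= sph_proj_val hc0' /hcoord linear0 -z12 in lray2.
have pE := ray_gradient_unique hM lray2 lray1.
set p := gradient f1 0 in lray1 pE.
have [C1dom _] := graph_chart_coord hM n_gt0 lray1.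
have C2dom : cdom C (gamma2 t0 s2) by rewrite -z12.
set H := hessian (fun x => f2 x - f1 x) 0 in hsigma.
have HE : H = hessian f2 0 - hessian f1 0 := hessianB U1o U1x f1C U2o U2x f2C.
pose d1 r := \det (hframe (gamma1 t0) c r (val s1)).
pose d2 r := \det (hframe (gamma2 t0) c r (val s2)).
have detE r1 r2 w : pos_frame s1 r1 -> pos_frame s2 r2 ->
    res_det C (gamma1 t0) (gamma2 t0) s1 s2 r1 r2 w
      = - (d1 r1 * d2 r2 * \det H * conormal_part p (lsubmx w)).
  move=> pr1 pr2; rewrite /res_det.
  rewrite (lift_frame hM leg1 hc hc0 ray1 xim U1o U1x f1C graph1 reg1 n_gt0
    pr1).
  rewrite (lift_frame hM leg2 hc' hc0' ray2 xim U2o U2x f2C graph2 reg2 n_gt0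
    pr2).
  rewrite det_col_mx_frames pE -/p det_jet_frame -mulmxBl -HE det_mulmx.
  rewrite det_reflection_mx // mulrN1 !mulrN; congr (- _).
  rewrite -[RHS]mulrA; congr (_ * _); rewrite [RHS]mulrC; congr (_ * _).
  by rewrite /conormal_part /vcoord /hcoord mxE [X in _ + X]mxE.
pose w := fun t => res_vector C (gamma1 t) (gamma2 t) s1 s2.
have cd1 := smooth_path_chart_differentiable hM smooth1 t0I C1dom.
have cd2 := smooth_path_chart_differentiable hM smooth2 t0I C2dom.
have wd : differentiable w t0 := differentiableB cd2 cd1.
have w0 : w t0 = 0 by rewrite /w /res_vector -z12 subrr.
pose rho t := conormal_part p (lsubmx (w t)).
pose wdot := 'D_1 w t0.
have lwd : differentiable (fun t => lsubmx (w t)) t0.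
  exact: (@differentiable_comp _ _ _ _ w lsubmx _ wd (differentiable_lsubmx _)).
have rhoD : is_derive t0 1 rho (conormal_part p (lsubmx wdot)).
  by rewrite -(derive_lsubmx _ wd); exact: conormal_part_derive.
have rho0 : rho t0 = 0.
  rewrite /rho w0 linear0 /conormal_part /vcoord /hcoord !linear0 mul0mx.
  by rewrite !mxE subrr.
set l := conormal_part p (lsubmx wdot) in rhoD.
have rho_slope : (t - t0)^-1 * rho t @[t --> t0^'+] --> l.
  by rewrite -(@derive_val _ _ _ _ _ _ _ rhoD); apply: right_slope rho0;
    exact: (@ex_derive _ _ _ _ _ _ _ rhoD).
(* in the determinant of the resolution only the factor rho depends on t, and it
   has the nonzero slope l at t0 *)
have sign_e r1 r2 : pos_frame s1 r1 -> pos_frame s2 r2 ->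
    e%:~R * (d1 r1 * d2 r2 * \det H * l) < 0.
  move=> pr1 pr2; have [] := hcross C r1 r2 C1dom pr1 pr2.
  rewrite detE // -/w -/wdot -/l oppr_eq0 => K0 _ Kpos.
  rewrite -oppr_gt0; apply: (@sign_of_right_limit R
    (fun t => - (e%:~R * (d1 r1 * d2 r2 * \det H * ((t - t0)^-1 * rho t)))) t0).
  - by apply: cvgN; apply: cvgMl_tmp; apply: cvgMl_tmp.
  - rewrite oppr_eq0 mulf_neq0 //.
    by case: e1 => ->; rewrite ?mulrN1z ?oppr_eq0 oner_eq0.
  - near=> t; have t0t : t0 < t by near: t; exact: nbhs_right_gt.
    have : 0 < e%:~R * res_det C (gamma1 t0) (gamma2 t0) s1 s2 r1 r2 (w t).
      by near: t.
    rewrite detE // -/(rho t) mulrN => Kt.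
    rewrite [_ * ((t - t0)^-1 * _)]mulrCA [e%:~R * _]mulrCA -mulrN.
    by rewrite mulr_gt0 // invr_gt0 subr_gt0.
have [H0 l0] : \det H != 0 /\ l != 0.
  have [+ _ _] := hcross C r10 r20 C1dom pr10 pr20.
  rewrite detE // -/w -/wdot -/l oppr_eq0 !mulf_eq0 !negb_or.
  by move=> /andP[/andP[_ ->] ->].
(* l is also the difference of the rates of the heights over the origin *)
have sign_alpha : alpha%:~R * l < 0 /\ (alpha = 1 \/ alpha = -1).
  have [u1 [u2 [over1 over2 hsign]]] := halpha.
  have hl1 := branch_height hM smooth1 t0I hc hc0 U1o U1x f1C graph1 over1.
  have hl2 := branch_height hM smooth2 t0I hc' hc0' U2o U2x f2C graph2 over2.
  rewrite pE -/p in hl2.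
  pose B1 t := cmap c (front (gamma1 t) s1).
  pose B2 t := cmap c (front (gamma2 t) s2).
  have wB : (fun t => lsubmx (w t)) = B2 - B1.
    apply/funext => t; rewrite /w /res_vector linearB /=.
    by congr (_ - _); exact: cosphere_base_coord.
  have B1d : differentiable B1 t0.
    have -> : B1 = fun t => lsubmx (cmap C (gamma1 t s1)).
      by apply/funext => t; rewrite cosphere_base_coord.
    exact: (differentiable_comp cd1 (differentiable_lsubmx _)).
  have B2d : differentiable B2 t0.
    have -> : B2 = fun t => lsubmx (cmap C (gamma2 t s2)).
      by apply/funext => t; rewrite cosphere_base_coord.
    exact: (differentiable_comp cd2 (differentiable_lsubmx _)).
  have lE : l = conormal_part p ('D_1 B2 t0) - conormal_part p ('D_1 B1 t0).
    rewrite -conormal_partB /l /wdot -(derive_lsubmx _ wd) wB.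
    by rewrite (deriveB (diff_derivable B2d) (diff_derivable B1d)).
  have hl : (t - t0)^-1 * vcoord (cmap c (front (gamma2 t) (u2 t))) -
      (t - t0)^-1 * vcoord (cmap c (front (gamma1 t) (u1 t)))
      @[t --> t0^'+] --> l.
    by rewrite lE; exact: cvgB hl2 hl1.
  case: hsign => [[-> hs]|[-> hs]]; split; [|by left| |by right].
  - rewrite mul1r -oppr_gt0; apply: sign_of_right_limit (cvgN hl) _ _.
      by rewrite oppr_eq0.
    near=> t; have t0t : t0 < t by near: t; exact: nbhs_right_gt.
    rewrite /= oppr_gt0 -mulrBr pmulr_rlt0 ?invr_gt0 ?subr_gt0 // subr_lt0.
    by near: t.
  - rewrite mulrN1z mulN1r oppr_lt0; apply: sign_of_right_limit hl l0 _.
    near=> t; have t0t : t0 < t by near: t; exact: nbhs_right_gt.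
    rewrite -mulrBr pmulr_rgt0 ?invr_gt0 ?subr_gt0 //.
    by near: t.
have sgH := sign_det_num_neg_eigenvalues H0; rewrite -hsigma in sgH.
set S := e * alpha * (-1) ^+ sigma.
have alpha1 : alpha = 1 \/ alpha = -1 by case: sign_alpha.
(* the sign of d1 * d2 is the same for all positive frames *)
have eps_sign r1 r2 : pos_frame s1 r1 -> pos_frame s2 r2 ->
    0 < S%:~R * (d1 r1 * d2 r2).
  move=> pr1 pr2; have se := sign_e _ _ pr1 pr2; have [sa _] := sign_alpha.
  have dH2 : 0 < \det H ^+ 2 * l ^+ 2.
    by rewrite mulr_gt0 // exprn_even_gt0.
  rewrite -(pmulr_lgt0 _ dH2).
  have -> : S%:~R * (d1 r1 * d2 r2) *
      (\det H ^+ 2 * l ^+ 2) = (e%:~R * (d1 r1 * d2 r2 * \det H * l)) *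
      (alpha%:~R * l) * ((-1) ^+ sigma * \det H).
    rewrite /S !rmorphM /= rmorphXn rmorphN rmorph1.
    by move: ((-1) ^+ sigma) => x; ring.
  by rewrite mulr_gt0 // nmulr_lgt0.
have sq1 : S ^+ 2 = 1.
  rewrite /S !exprMn sqrr_sign mulr1.
  by case: e1 => ->; case: alpha1 => ->; rewrite ?sqrrN ?expr1n ?mulr1.
suff -> : epsilon = S.
  have ss : (-1) ^+ sigma * (-1) ^+ sigma = 1 :> int by rewrite -expr2 sqrr_sign.
  have aa : alpha * alpha = 1 by case: alpha1 => ->.
  have -> : S * alpha * (-1) ^+ sigma
      = e * (alpha * alpha) * ((-1) ^+ sigma * (-1) ^+ sigma).
    by rewrite /S; move: ((-1) ^+ sigma) => x; ring.
  by rewrite ss aa !mulr1.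
have S1 : S = 1 \/ S = -1.
  by move/eqP: sq1; rewrite sqrf_eq1 => /orP[]/eqP; [left|right].
have frame1 := front_frame hM leg1 hc hc0 U1o U1x f1C graph1.
have frame2 := front_frame hM leg2 hc' hc0' U2o U2x f2C graph2.
rewrite hepsilon; case: asboolP => [same|diff].
  have [P [P0]] := same r10 r20 pr10 pr20.
  rewrite frame1 frame2 pE -/p mulmxA !mul_mx_row !mulmx1 => /eq_row_mx[X2E _].
  have := eps_sign _ _ pr10 pr20; rewrite /d2 X2E det_mulmx -/(d1 r10).
  case: S1 => -> //; rewrite mulrN1z mulN1r oppr_gt0 mulrCA.
  by rewrite pmulr_rlt0 // -expr2 ltNge sqr_ge0.
case: S1 => // S1; case: diff => r1 r2 pr1 pr2.
have d10 : d1 r1 != 0.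
  exact: (hframe_det_neq0 hM leg1 hc hc0 U1o U1x f1C graph1 reg1 pr1).
have X1u : hframe (gamma1 t0) c r1 (val s1) \in unitmx by rewrite unitmxE unitfE.
exists (hframe (gamma2 t0) c r2 (val s2)
  *m invmx (hframe (gamma1 t0) c r1 (val s1))).
split; last by rewrite frame1 frame2 pE -/p mulmxA mulmxKV.
have := eps_sign _ _ pr1 pr2.
rewrite S1 mul1r det_mulmx det_inv -/(d1 r1) -/(d2 r2) mulrC => d21.
rewrite -(pmulr_lgt0 _ (_ : 0 < d1 r1 ^+ 2)).
  by rewrite expr2 mulrA mulfVK.
by rewrite exprn_even_gt0.
Unshelve. all: by end_near. Qed.
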